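(* Normalize $\nu=1$ and $T=1$. For every $K>0$ there exist a nonnegative $g\in C^\infty([0,1))$ and a bounded nonnegative solution $q=q(r,t)$ of $$q_t=q_{rr}+g(t)q_r\quad (r>0,\ 0<t<1),\qquad q(0,t)=0,$$ with smooth bounded nondecreasing initial data, such that $$\int_{1-h}^{1}g(t)\,dt\le K\sqrt{h\log\log(e^e/h)}$$ for every sufficiently small $h>0$, but there are $t_n\uparrow1$ and $r_n\downarrow0$ for which $$q(r_n,t_n)\,|\log r_n|^{3/2}\longrightarrow\infty .$$ In particular, the terminal-only bound on $\int_{1-h}^1 g$ above does not imply a uniform logarithmic modulus of the form $q(r,t)\le C|\log r|^{-3/2}$ (for small $r$) on preterminal times.
   Context: The problem is a one-dimensional drift-diffusion equation on the half-line $r>0$ with Dirichlet condition at $r=0$, with initial data prescribed at $t=0$. *)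

(* Defs.v *)
From HB Require Import structures.
From mathcomp Require Import all_boot all_order all_algebra.
From mathcomp Require Import all_classical all_reals all_analysis.

Set Implicit Arguments.
Unset Strict Implicit.
Unset Printing Implicit Defensive.

Import Order.TTheory GRing.Theory Num.Theory.
Import numFieldNormedType.Exports.

Local Open Scope classical_set_scope.
Local Open Scope ring_scope.

(* C^oo(D) up to the endpoints that belong to D: the [n]-th derivative [F n] is
   the limit of difference quotients taken inside D, hence one-sided at an
   endpoint, and values of [f] outside D play no role. Meaningful when D has no
   isolated point; it is used for [0, 1) and [0, +oo). *)
Definition smooth_on (R : realType) (D : set R) (f : R -> R) : Prop :=
  exists F : nat -> R -> R,
    (forall x, D x -> F 0%N x = f x) /\
    (forall (n : nat) (x : R), D x ->
      (F n y - F n x) / (y - x) @[y --> within D x^'] --> F n.+1 x).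

Definition drift (R : realType) (g : R -> R) : Prop :=
  smooth_on `[0, 1[%classic g /\ (forall t, 0 <= t < 1 -> 0 <= g t).

(* Partial derivatives of [q], as functions of the pair (r, t). *)
Definition dt (R : realType) (q : R -> R -> R) (p : R * R) : R :=
  derive1 (q p.1) p.2.
Definition dr (R : realType) (q : R -> R -> R) (p : R * R) : R :=
  derive1 (q^~ p.2) p.1.
Definition drr (R : realType) (q : R -> R -> R) (p : R * R) : R :=
  derive1n 2 (q^~ p.2) p.1.

(* The derivatives above are total functions, so differentiability is required
   separately. *)
Definition C21_at (R : realType) (q : R -> R -> R) (r t : R) : Prop :=
  [/\ derivable (q r) t 1,
      derivable (q^~ t) r 1 &
      derivable (derive1 (q^~ t)) r 1] /\
  [/\ {for (r, t), continuous (dt q)},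
      {for (r, t), continuous (dr q)} &
      {for (r, t), continuous (drr q)}].

(* Classical solution of the Dirichlet problem on r > 0, 0 < t < 1. Continuity
   up to r = 0 and t = 0 is what makes the boundary condition and the initial
   data [q^~ 0] be attained. *)
Definition dirichlet_solution (R : realType) (g : R -> R) (q : R -> R -> R) :
    Prop :=
  [/\ {within `[0, +oo[%classic `*` `[0, 1[%classic,
        continuous (fun p : R * R => q p.1 p.2)},
      (forall r t, 0 < r -> 0 < t < 1 ->
        C21_at q r t /\ dt q (r, t) = drr q (r, t) + g t * dr q (r, t)) &
      (forall t, 0 <= t < 1 -> q 0 t = 0)].

Definition bounded_nonneg (R : realType) (q : R -> R -> R) : Prop :=
  exists M : R, forall r t, 0 <= r -> 0 <= t < 1 -> 0 <= q r t <= M.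

Definition smooth_bounded_nondecreasing (R : realType) (q0 : R -> R) : Prop :=
  [/\ smooth_on `[0, +oo[%classic q0,
      (exists M : R, forall r, 0 <= r -> `|q0 r| <= M) &
      (forall r s, 0 <= r -> r <= s -> q0 r <= q0 s)].

Definition drift_diffusion_pair (R : realType) (g : R -> R) (q : R -> R -> R) :
    Prop :=
  [/\ drift g, dirichlet_solution g q, bounded_nonneg q &
      smooth_bounded_nondecreasing (q^~ 0)].

(* [g] may blow up at t = 1; as [g] >= 0 the Lebesgue integral below is the
   improper integral, and the bound contains its convergence. *)
Definition terminal_bound (R : realType) (K : R) (g : R -> R) : Prop :=
  \forall h \near (0 : R)^'+,
    (\int[@lebesgue_measure R]_(t in `[(1 - h)%R, 1%R[) (g t)%:E <=
     (K * Num.sqrt (h * ln (ln (expR (expR 1) / h))))%:E)%E.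

Definition log_modulus (R : realType) (q : R -> R -> R) : Prop :=
  exists C : R, \forall r \near (0 : R)^'+,
    forall t, 0 < t < 1 -> q r t <= C * `|ln r| `^ (- (3 / 2)).

(* Main.v *)
(* In the coordinate x = r + G(t), with G' = g, the equation becomes the heat
   equation u_t = u_xx on x > G(t), with u = 0 at x = G(t). We go the other way
   round: start from an explicit caloric function u and let G(t) be the largest
   zero of u(., t). Where u_x > 0 and u_xx <= 0 the front G is nondecreasing and
   as smooth as u, and g = G' = - u_xx / u_x.
   Take u = 1 - exp (t - x) - sum_n b_n P_n, where P_n, launched at time
   1 - 2^-(n+1), is a nearly travelling wave of very large speed v_n which is
   stopped after a very short time T_n with v_n T_n = m_n fixed. While it runs it
   drags the front along, so that the front enters the region where u was
   already bounded below: at the stopping time q is bounded below at a distance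
   of order 1 / v_n from the front, with a bound that does not depend on v_n.
   This beats any power of the logarithm if v_n is large enough. The
   amplitudes b_n, which control the total displacement of the front over
   [1 - h, 1), can be as small as one likes. *)

Require Import Defs.
From HB Require Import structures.
From mathcomp Require Import all_boot all_order all_algebra.
From mathcomp Require Import all_classical all_reals all_analysis.
From mathcomp Require Import measurable_realfun ring lra.

Set Implicit Arguments.
Unset Strict Implicit.
Unset Printing Implicit Defensive.

Import Order.TTheory GRing.Theory Num.Theory.
Import numFieldNormedType.Exports.

Local Open Scope classical_set_scope.
Local Open Scope ring_scope.

(** * Derivatives on the real line *)

(** Monotonicity and concavity of u are needed on the whole half-line ahead of the front and at all
    later times, since each wave is superposed on what the earlier ones left. Stopping a wave
    threatens them. The cure rests on one fact: along lines of slope [v] the derivatives of a wave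
    change at a rate given by the plain heat kernel, without [v]. So a wave minus its relaunched
    copy is at most 1, with second derivative of order 1 / (v tau^(3/2)), [tau] being the time since
    the stop; at distance at least 1 / v from the stopping point a fixed multiple of a heat step
    outweighs this error. Launch and relaunch points stay behind the front. A small amplitude [b]
    still drags the front, since the speed of a wave does not depend on [b]: it only limits the
    distance [m], over which u must stay below b / (2 e). So [b], then [m], then the lower bound on
    u near the stopping place are fixed before [v], which is free to be as large as the logarithm
    demands. Since u_x is bounded below near the front, its displacement is controlled by the
    increase of the perturbation at a fixed point, and each wave gets a share of a budget k sqrt (1
    - t). *)

Section RealDerivative.
Context {R : realType}.
Implicit Types (f g : R -> R) (a b x : R).

Lemma is_derive_continuous f x d : is_derive x 1 f d -> {for x, continuous f}.
Proof. by case=> df _; apply/differentiable_continuous/derivable1_diffP. Qed.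

Lemma mean_value f df a b : a < b ->
  (forall x, a <= x <= b -> is_derive x 1 f (df x)) ->
  exists2 c, a < c < b & f b - f a = df c * (b - a).
Proof.
move=> ab fdf.
have [||c] := @MVT R f df a b ab; last by rewrite in_itv /=; exists c.
  by move=> x; rewrite in_itv /= => /andP[ax xb]; apply: fdf; rewrite !ltW.
apply: derivable_within_continuous => x; rewrite in_itv /= => /fdf.
by case.
Qed.

Lemma le_of_derive_ge0 f df a b : a <= b ->
  (forall x, a <= x <= b -> is_derive x 1 f (df x)) ->
  (forall x, a <= x <= b -> 0 <= df x) -> f a <= f b.
Proof.
rewrite le_eqVlt => /predU1P[-> //|ab] fdf df0.
have [c /andP[ac cb] e] := mean_value ab fdf.
by rewrite -subr_ge0 e mulr_ge0 ?subr_ge0 ?(ltW ab)// df0// !ltW.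
Qed.

Lemma lt_of_derive_gt0 f df a b : a < b ->
  (forall x, a <= x <= b -> is_derive x 1 f (df x)) ->
  (forall x, a <= x <= b -> 0 < df x) -> f a < f b.
Proof.
move=> ab fdf df0; have [c /andP[ac cb] e] := mean_value ab fdf.
by rewrite -subr_gt0 e mulr_gt0 ?subr_gt0 ?(ltW ab)// df0// !ltW.
Qed.

Lemma ge_of_derive_le0 f df a b : a <= b ->
  (forall x, a <= x <= b -> is_derive x 1 f (df x)) ->
  (forall x, a <= x <= b -> df x <= 0) -> f b <= f a.
Proof.
move=> ab fdf df0; rewrite -lerN2.
apply: (@le_of_derive_ge0 (- f) (fun x => - df x)) => // x xab.
  by have := fdf _ xab => ?; apply: is_deriveN.
by rewrite oppr_ge0 df0.
Qed.

Lemma sub_le_of_derive_le f g df dg a b : a <= b ->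
  (forall x, a <= x <= b -> is_derive x 1 f (df x)) ->
  (forall x, a <= x <= b -> is_derive x 1 g (dg x)) ->
  (forall x, a <= x <= b -> df x <= dg x) -> f b - f a <= g b - g a.
Proof.
move=> ab fdf gdg dfg.
have : (g - f) a <= (g - f) b.
  apply: (@le_of_derive_ge0 _ (fun x => dg x - df x)) => // x xab.
    by have := fdf _ xab; have := gdg _ xab => ? ?; apply: is_deriveB.
  by rewrite subr_ge0 dfg.
by rewrite !fctE; lra.
Qed.

End RealDerivative.

(** * The Gaussian tail *)

Section GaussTail.
Context {R : realType}.
Implicit Types x y : R.

Definition bell x : R := expR (- (x ^+ 2 / 4)).

Lemma bell_gt0 x : 0 < bell x. Proof. exact: expR_gt0. Qed.

Lemma bellN x : bell (- x) = bell x. Proof. by rewrite /bell sqrrN. Qed.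

Let sd : R := Num.sqrt 2.
Let k : R := normal_pdf 0 sd 0.

Let sd0 : sd != 0. Proof. by rewrite gt_eqF// sqrtr_gt0. Qed.

Let k_gt0 : 0 < k.
Proof.
rewrite /k /normal_pdf (negbTE sd0) mulr_gt0 ?expR_gt0//.
by rewrite normal_peak_gt0.
Qed.

Let normal_pdf_bell x : normal_pdf 0 sd x = k * bell x.
Proof.
rewrite /k /normal_pdf (negbTE sd0) /normal_fun /bell subr0 subrr.
rewrite expr0n /= oppr0 mul0r expR0 mulr1 sqr_sqrtr//; congr (_ * expR _).
by rewrite -mulr_natr; field.
Qed.

Let cdf x : R := (\int[lebesgue_measure]_(t in `]-oo, x]) normal_pdf 0 sd t)%R.

Let cdf01 x : 0 <= cdf x <= 1.
Proof.
have i0 : (0 <= \int[lebesgue_measure]_(t in `]-oo, x]) (normal_pdf 0 sd t)%:E)%E.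
  by apply: integral_ge0 => t _; rewrite lee_fin normal_pdf_ge0.
have i1 : (\int[lebesgue_measure]_(t in `]-oo, x]) (normal_pdf 0 sd t)%:E <= 1)%E.
  rewrite -(@integral_normal_pdf R 0 sd); apply: ge0_subset_integral => //=.
    apply/measurable_EFinP/measurable_funTS; exact: measurable_normal_pdf.
  by move=> t _; rewrite lee_fin normal_pdf_ge0.
rewrite /cdf /Rintegral -!lee_fin fineK ?i0 ?i1//.
by rewrite ge0_fin_numE// (le_lt_trans i1)// ltry.
Qed.

Let is_derive_cdf x : is_derive x 1 cdf (k * bell x).
Proof.
have [||||h1 h2] :=
    @continuous_FTC1 R (normal_pdf 0 sd) (BInfty R true) x (x + 1).
- by rewrite ltrDl.
- by apply: integrableS (integrable_normal_pdf 0 sd).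
- exact: ltNyr.
- exact: continuous_normal_pdf.
rewrite -normal_pdf_bell -h2 derive1E; exact: derivableP.
Qed.

Let F x : R := cdf x - cdf 0.

Let is_derive_F x : is_derive x 1 F (k * bell x).
Proof.
by have := is_derive_cdf x => ?; apply: is_derive_eq; rewrite subr0.
Qed.

Let FN x : F (- x) = - F x.
Proof.
have d y : is_derive y 1 (fun z => F z + (F \o -%R) z) 0.
  have := is_derive_F y => ?; have := is_derive_F (- y) => ?.
  by apply: is_derive_eq; rewrite bellN; ring.
have e a b : a <= b -> F a + F (- a) = F b + F (- b).
  move=> ab; apply/eqP; rewrite eq_le; apply/andP; split.
    exact: (@le_of_derive_ge0 _ (fun z => F z + (F \o -%R) z) (fun=> 0)).
  exact: (@ge_of_derive_le0 _ (fun z => F z + (F \o -%R) z) (fun=> 0)).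
have F0 : F 0 = 0 by rewrite /F subrr.
have /orP[/e|/e] := le_total x 0; rewrite !oppr0 !F0; lra.
Qed.

Let F_le a b : a <= b -> F a <= F b.
Proof.
move=> ab; apply: (@le_of_derive_ge0 _ F (fun x => k * bell x)) => // x _.
by rewrite mulr_ge0 // ltW// bell_gt0.
Qed.

Let L : R := sup (range F).

Let F_sup : has_sup (range F).
Proof.
split; first by exists (F 0); exists 0.
exists 1 => _ [y _ <-]; have := cdf01 y; have := cdf01 0; rewrite /F; lra.
Qed.

Let F_leL y : F y <= L.
Proof. by apply: sup_upper_bound => //; exists y. Qed.

Let L_gt0 : 0 < L.
Proof.
apply: lt_le_trans (F_leL 1); have -> : 0 = F 0 by rewrite /F subrr.
apply: (@lt_of_derive_gt0 _ F (fun x => k * bell x)) => // x _.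
by rewrite mulr_gt0 // bell_gt0.
Qed.

(** Integrate [bell (z + y) <= bell y * bell z], valid for nonnegative arguments, over [[0, s]]; the
    supremum over [s] turns the increment of [F] beyond [y] into [L - F y]. *)
Let F_tail y : 0 <= y -> L - F y <= L * bell y.
Proof.
move=> y0; have h s : 0 <= s -> F (s + y) - F y <= bell y * F s.
  move=> s0.
  have := @sub_le_of_derive_le R (F \o shift y) (bell y \*o F)
    (fun z => k * bell (z + y)) (fun z => bell y * (k * bell z)) 0 s s0.
  rewrite /= add0r; have -> : F 0 = 0 by rewrite /F subrr.
  rewrite mulr0 subr0; apply => z zs.
  - have := is_derive_F (shift y z) => ?; have := is_derive_shift z 1 y => ?.
    by apply: is_derive_eq; rewrite mulr1.
  - by have := is_derive_F z => ?; apply: is_derive_eq.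
  rewrite mulrCA ler_pM2l// /bell -expRD ler_expR.
  by have := mulr_ge0 y0 (andP zs).1; lra.
rewrite lerBlDr; apply: ge_sup; first by exists (F 0); exists 0.
move=> _ [z _ <-]; have [zy|yz] := leP z y.
  apply: le_trans (F_le zy) _; rewrite lerDr mulr_ge0 ?ltW ?bell_gt0//.
have := h (z - y); rewrite subrK subr_ge0 (ltW yz) => /(_ erefl).
have := F_leL (z - y); rewrite -(ler_pM2l (bell_gt0 y)).
lra.
Qed.

(** This is erfc (x / 2) / 2, and [bell_weight] is 1 / (2 sqrt pi). Dividing by the supremum [L]
    yields the reflection formula and the bounds 0 and 1 without evaluating a Gaussian integral. *)
Definition tail x : R := (L - F x) / (2 * L).
Definition bell_weight : R := k / (2 * L).

Lemma bell_weight_gt0 : 0 < bell_weight.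
Proof. by rewrite divr_gt0// mulr_gt0. Qed.

Lemma is_derive_tail x : is_derive x 1 tail (- (bell_weight * bell x)).
Proof.
have := is_derive_F x => ?.
rewrite /tail; apply: is_derive_eq; rewrite /GRing.scale /= /bell_weight.
by field; rewrite gt_eqF.
Qed.

Lemma tail_ge0 x : 0 <= tail x.
Proof. by rewrite divr_ge0 ?subr_ge0// mulr_ge0// ltW. Qed.

Lemma tailN x : tail (- x) = 1 - tail x.
Proof. by rewrite /tail FN; field; rewrite gt_eqF. Qed.

Lemma tail_le1 x : tail x <= 1.
Proof. by rewrite -[x]opprK tailN gerBl tail_ge0. Qed.

Lemma tail_ge_half x : x <= 0 -> 2^-1 <= tail x.
Proof.
move=> x0; rewrite /tail ler_pdivlMr ?mulr_gt0// mulKf//.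
by rewrite lerDl oppr_ge0 (le_trans (F_le x0))// /F subrr.
Qed.

Lemma tail_le_bell x : 0 <= x -> tail x <= bell x.
Proof.
move=> x0; rewrite /tail ler_pdivrMr ?mulr_gt0//.
apply: le_trans (F_tail x0) _.
by have := mulr_gt0 (bell_gt0 x) L_gt0; lra.
Qed.

End GaussTail.

(** * Derivatives and neighbourhoods in epsilon form *)

Section DerivativeEps.
Context {R : realType}.
Implicit Types (f : R -> R) (x d : R).

Lemma near_dist_lt x e : 0 < e -> \forall y \near x, `|y - x| < e.
Proof.
move=> e0; near do rewrite distrC.
by apply/nbhs_ballP; exists e.
Unshelve. all: by end_near. Qed.

Lemma is_deriveP f x d : is_derive x 1 f d <->
  forall e, 0 < e -> \forall y \near x, `|f y - f x - d * (y - x)| <= e * `|y - x|.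
Proof.
have eq h : h != 0 ->
    `|d - h^-1 *: (f (h *: 1 + x) - f x)| = `|f (h + x) - f x - d * h| / `|h|.
  move=> h0; rewrite -normfV -normrM -normrN /GRing.scale /= mulr1.
  by congr `|_|; field.
have -> : is_derive x 1 f d <->
    (h^-1 *: (f (h *: 1 + x) - f x)) @[h --> 0^'] --> d.
  split=> [[df <-]|df]; first exact: df.
  by apply: DeriveDef; [apply/cvg_ex; exists d|apply/cvg_lim].
split=> [/cvgrPdist_le df e e0|df].
  apply/nbhs0P.
  have := df _ e0; rewrite near_withinE; apply: filterS => h.
  rewrite [x + h]addrC addrK; have [-> _|h0 /(_ isT)] := eqVneq h 0.
    by rewrite add0r addrN mulr0 subr0 normr0 mulr0.
  by rewrite eq// ler_pdivrMr ?normr_gt0.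
apply/cvgrPdist_le => e e0; have /nbhs0P := df _ e0.
rewrite near_withinE; apply: filterS => h + h0.
by rewrite eq// [x + h]addrC addrK ler_pdivrMr ?normr_gt0.
Qed.

Lemma is_derive_sq_le f x d C :
  (\forall y \near x, `|f y - f x - d * (y - x)| <= C * (y - x) ^+ 2) ->
  is_derive x 1 f d.
Proof.
move=> h; apply/is_deriveP => e e0; near=> y.
apply: le_trans (near h y _) _ => //.
rewrite -[_ ^+ 2]real_normK ?num_real// expr2 mulrA ler_wpM2r//.
apply: (@le_trans _ _ ((`|C| + 1) * `|y - x|)).
  by rewrite ler_wpM2r//; apply: le_trans (ler_norm C) _; lra.
rewrite -ler_pdivlMl ?ltr_wpDl//.
apply: ltW; near: y; apply: near_dist_lt.
by rewrite mulr_gt0// invr_gt0 ltr_wpDl.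
Unshelve. all: by end_near. Qed.

Lemma is_derive_affine (f : R -> R) x a b : (forall y, f y = a + b * y) -> is_derive x 1 f b.
Proof.
move=> fE; apply/is_deriveP => e e0; near=> y.
have -> : f y - f x - b * (y - x) = 0 by rewrite !fE; ring.
by rewrite normr0 mulr_ge0// ltW.
Unshelve. all: by end_near. Qed.

End DerivativeEps.

Section PairNear.
Context {R : realType}.
Implicit Types (x t : R).

Lemma near_distP x (P : R -> Prop) : (\forall y \near x, P y) <->
  exists2 e, 0 < e & forall y, `|y - x| < e -> P y.
Proof.
split=> [/nbhs_ballP[e /= e0 h]|[e e0 h]].
  by exists e => // y yx; apply: h; rewrite /ball /= distrC.
by apply/nbhs_ballP; exists e => //= y; rewrite /ball /= distrC; exact: h.
Qed.

Lemma near_pairP x t (Q : R * R -> Prop) : (\forall p \near (x, t), Q p) <->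
  exists2 e, 0 < e & forall y s, `|y - x| < e -> `|s - t| < e -> Q (y, s).
Proof.
split=> [[[A B] /= [/near_distP[a a0 hA] /near_distP[b b0 hB]] AB]|[e e0 h]].
  exists (Num.min a b); first by rewrite lt_min a0.
  by move=> y s; rewrite !lt_min => /andP[ya _] /andP[_ sb]; apply: AB; split; [exact: hA|exact: hB].
exists ([set y | `|y - x| < e], [set s | `|s - t| < e]).
  by split; apply/near_distP; exists e.
by move=> [y s] /= [? ?]; exact: h.
Qed.

Lemma near_fst x t (P : R -> Prop) :
  (\forall y \near x, P y) -> \forall p \near (x, t), P p.1.
Proof.
by move=> /near_distP[e e0 h]; apply/near_pairP; exists e => //= y s yx _; exact: h.
Qed.

Lemma near_snd x t (P : R -> Prop) :
  (\forall s \near t, P s) -> \forall p \near (x, t), P p.2.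
Proof.
by move=> /near_distP[e e0 h]; apply/near_pairP; exists e => //= y s _ st; exact: h.
Qed.

End PairNear.

(** * Caloric functions *)

Section Tower.
Context {R : realType}.
Implicit Types (w : nat -> R -> R -> R) (x t : R).

(* [w j] stands for the [j]-th space derivative, and the heat equation turns
   the time derivative into two space derivatives. *)
Definition caloric_at w x t : Prop := forall j,
  [/\ is_derive x 1 (w j ^~ t) (w j.+1 x t),
      is_derive t 1 (w j x) (w j.+2 x t) &
      {for (x, t), continuous (fun p : R * R => w j p.1 p.2)}].

Lemma caloric_atD w1 w2 x t : caloric_at w1 x t -> caloric_at w2 x t ->
  caloric_at (fun j x t => w1 j x t + w2 j x t) x t.
Proof.
move=> c1 c2 j; have [? ? ?] := c1 j; have [? ? ?] := c2 j; split.
- exact: is_deriveD.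
- exact: is_deriveD.
- by apply: cvgD.
Qed.

Lemma caloric_atZ w k x t : caloric_at w x t ->
  caloric_at (fun j x t => k * w j x t) x t.
Proof.
move=> c j; have [? ? ?] := c j; split.
- exact: is_deriveZ.
- exact: is_deriveZ.
- by apply: cvgMr.
Qed.

Lemma caloric_at_shift w a s x t : caloric_at w (x - a) (t - s) ->
  caloric_at (fun j x t => w j (x - a) (t - s)) x t.
Proof.
move=> c j; have [d1 d2 c0] := c j; split.
- have := is_derive_shift x 1 (- a) => ?.
  have : is_derive x 1 ((w j ^~ (t - s)) \o shift (- a)) (w j.+1 (x - a) (t - s) * 1).
    exact: is_derive1_comp.
  by rewrite mulr1.
- have := is_derive_shift t 1 (- s) => ?.
  have : is_derive t 1 (w j (x - a) \o shift (- s)) (w j.+2 (x - a) (t - s) * 1).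
    exact: is_derive1_comp.
  by rewrite mulr1.
- move=> U /c0 /near_pairP[e e0 h]; apply/near_pairP; exists e => // y r yx rt.
  by apply: h; rewrite opprB addrA subrK.
Qed.

Lemma caloric_at_near w1 w2 x t :
  (\forall t' \near t, forall j x, w1 j x t' = w2 j x t') ->
  caloric_at w1 x t -> caloric_at w2 x t.
Proof.
move=> e c j; have [d1 d2 c0] := c j.
have et i y : w1 i y t = w2 i y t by have /(_ i y) := nbhs_singleton e.
split.
- have -> : w2 j ^~ t = w1 j ^~ t by apply/funext => y; rewrite et.
  by rewrite -et.
- rewrite -et; apply: near_eq_is_derive d2.
  by apply: filterS e => t'; exact.
- rewrite /continuous_at /prop_for /= -et; apply: cvg_trans c0; apply: near_eq_cvg.
  by apply: filterS (@near_snd _ x t _ e) => p; rewrite /=.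
Qed.

(** Bounded [x] makes the notion stable under multiplication by [x], and all orders at once make it
    stable under division by [t]: these are the operations of the Hermite recursion. *)
Definition flat (f : R -> R -> R) : Prop := forall a m k, 0 < a ->
  exists C, forall x t, a <= x <= m -> 0 < t <= 1 -> `|f x t| <= C * t ^+ k.

Lemma flatD f1 f2 : flat f1 -> flat f2 -> flat (fun x t => f1 x t + f2 x t).
Proof.
move=> h1 h2 a m k a0; have [C1 {}h1] := h1 a m k a0; have [C2 {}h2] := h2 a m k a0.
exists (C1 + C2) => x t xa t0; rewrite mulrDl; apply: le_trans (ler_normD _ _) _.
by rewrite lerD ?h1 ?h2.
Qed.

Lemma flatZ f k : flat f -> flat (fun x t => k * f x t).
Proof.
move=> h a m n a0; have [C {}h] := h a m n a0; exists (`|k| * C) => x t xa t0.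
by rewrite normrM -mulrA ler_wpM2l// h.
Qed.

Lemma flat_xM f : flat f -> flat (fun x t => x * f x t).
Proof.
move=> h a m n a0; have [C {}h] := h a m n a0; exists (m * C) => x t xa t0.
have x0 : 0 < x by apply: lt_le_trans a0 _; case/andP: xa.
by rewrite normrM gtr0_norm// -mulrA ler_pM ?h ?normr_ge0 ?(ltW x0)//; case/andP: xa.
Qed.

Lemma flat_divt f : flat f -> flat (fun x t => f x t / t).
Proof.
move=> h a m n a0; have [C {}h] := h a m n.+1 a0; exists C => x t xa t0.
have t1 : 0 < t by case/andP: t0.
rewrite normrM normfV (gtr0_norm t1) ler_pdivrMr// -mulrA -exprSr.
exact: h.
Qed.

(** Raise u <= exp u, at u = y / (n + 1), to the power n + 1. *)
Lemma expRN_le n (y : R) : 0 < y -> expR (- y) <= (n.+1%:R / y) ^+ n.+1.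
Proof.
move=> y0; rewrite expRN -[leRHS]invrK lef_pV2 ?posrE ?expR_gt0 ?invr_gt0 ?exprn_gt0 ?divr_gt0//.
rewrite -exprVn invf_div.
have {2}-> : y = n.+1%:R * (y / n.+1%:R) by field; rewrite gt_eqF// ltr0Sn.
rewrite expRM_natl; apply: lerXn2r; rewrite ?nnegrE ?expR_ge0 ?divr_ge0 ?ltW//.
by apply: lt_le_trans (expR_ge1Dx _); rewrite ltrDr.
Qed.

Lemma flat_exp : flat (fun x t => expR (- (x ^+ 2 / (4 * t)))).
Proof.
move=> a m k a0; exists ((k.+1%:R * 4 / a ^+ 2) ^+ k.+1) => x t /andP[ax _] /andP[t0 t1].
have x0 := lt_le_trans a0 ax; have a20 : 0 < a ^+ 2 by rewrite exprn_gt0.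
rewrite gtr0_norm ?expR_gt0//.
apply: (@le_trans _ _ (expR (- (a ^+ 2 / (4 * t))))).
  rewrite ler_expR lerN2 ler_pM2r ?invr_gt0 ?mulr_gt0//.
  by apply: lerXn2r; rewrite // nnegrE ltW.
apply: le_trans (expRN_le k _) _; first by rewrite divr_gt0// mulr_gt0.
have -> : k.+1%:R / (a ^+ 2 / (4 * t)) = (k.+1%:R * 4 / a ^+ 2) * t.
  by field; rewrite !gt_eqF.
rewrite exprMn ler_pM2l ?exprn_gt0 ?divr_gt0 ?mulr_gt0//.
by rewrite exprS ger_pMl// exprn_gt0.
Qed.

Lemma flat_le f g : flat g ->
  (forall x t, 0 < x -> 0 < t -> `|f x t| <= `|g x t|) -> flat f.
Proof.
move=> h fg a m n a0; have [C {}h] := h a m n a0; exists C => x t xa t0.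
apply: le_trans (fg _ _ _ _) (h _ _ _ _) => //; last by case/andP: t0.
by case/andP: xa => + _; exact: lt_le_trans.
Qed.

(* Extension by 0 across t = 0: the data are flat to all orders where x > 0. *)
Lemma caloric_extend w x t :
  (forall j x t, t <= 0 -> w j x t = 0) ->
  (forall x t, 0 < t -> caloric_at w x t) ->
  (forall j, flat (w j)) ->
  t != 0 \/ 0 < x -> caloric_at w x t.
Proof.
move=> w0 wc wf; have [t0 _|t0 _|->] := ltgtP t 0.
- apply: (@caloric_at_near (fun _ _ _ => 0)).
    near=> t' => j y; rewrite w0//.
    by near: t'; apply: lt_le_nbhsl.
  by move=> j; split; [exact: is_derive_cst|exact: is_derive_cst|exact: cvg_cst].
- exact: wc.
move=> [//|x0] j.
(* Order 2 gives both continuity and a vanishing time derivative at t = 0. *)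
have [C hC] := wf j (x / 2) (x + 1) 2%N (divr_gt0 x0 (ltr0n _ 2)).
have C0 : 0 <= C.
  have := hC x 1; rewrite expr1n mulr1 => h; apply: le_trans (normr_ge0 _) (h _ _); lra.
have hC' y s : x / 2 <= y <= x + 1 -> s <= 1 -> `|w j y s| <= C * s ^+ 2.
  move=> hy s1; have [s0|s0] := leP s 0; last by rewrite hC ?s0.
  by rewrite w0// normr0 mulr_ge0// sqr_ge0.
split.
- have -> : w j ^~ 0 = cst 0 by apply/funext => y; rewrite w0.
  by rewrite w0//; exact: is_derive_cst.
- rewrite [w j.+2 x 0]w0//; apply: (@is_derive_sq_le _ _ _ _ C); near=> s.
  rewrite (w0 j x 0)// mul0r !subr0; apply: hC'; last by near: s; exact: lt_le_nbhsl.
  by lra.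
apply/cvgrPdist_le => e e0; near=> p.
rewrite [w j _ _]w0//= sub0r normrN.
apply: (@le_trans _ _ (C * p.2 ^+ 2)).
  apply: hC'.
    apply/andP; split; near: p.
      by apply: (@near_fst _ x 0 (fun y => x / 2 <= y)); apply: lt_le_nbhsr; lra.
    by apply: (@near_fst _ x 0 (fun y => y <= x + 1)); apply: lt_le_nbhsl; lra.
  by near: p; apply: (@near_snd _ x 0 (fun y => y <= 1)); apply: lt_le_nbhsl.
have p2 : `|p.2| < Num.min 1 (e / (C + 1)).
  near: p; apply: (@near_snd _ x 0 (fun y => `|y| < _)).
  apply/near_distP; exists (Num.min 1 (e / (C + 1))); last by move=> y; rewrite subr0.
  by rewrite lt_min ltr01 divr_gt0// ltr_wpDl.
move: p2; rewrite lt_min => /andP[p1 pe].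
rewrite -[p.2 ^+ 2]real_normK ?num_real// expr2 mulrA.
apply: (@le_trans _ _ ((C + 1) * `|p.2|)); last first.
  by rewrite -ler_pdivlMl ?ltr_wpDl// mulrC ltW.
by rewrite -mulrA ler_pM ?mulr_ge0// ?lerDl// ler_piMl// ltW.
Unshelve. all: by end_near. Qed.

End Tower.

(** * Chain rule along a moving point *)

Section ChainRule.
Context {R : realType}.
Implicit Types (w : R -> R -> R) (x t : R).

Lemma partial_slope w (w1 : R -> R -> R) x t :
  (\forall p \near (x, t), is_derive (p.1 : R) 1 (w ^~ p.2) (w1 p.1 p.2)) ->
  {for (x, t), continuous (fun p : R * R => w1 p.1 p.2)} ->
  forall e, 0 < e -> \forall p \near (x, t),
    `|w p.1 p.2 - w x p.2 - w1 x t * (p.1 - x)| <= e * `|p.1 - x|.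
Proof.
move=> /near_pairP[d1 d10 dw] /cvgrPdist_le c e e0.
have /near_pairP[d2 d20 {}c] := c e e0.
apply/near_pairP; exists (Num.min d1 d2); first by rewrite lt_min d10.
move=> y s; rewrite !lt_min /= => /andP[yd1 yd2] /andP[sd1 sd2].
have box z : `|z - x| <= `|y - x| -> is_derive z 1 (w ^~ s) (w1 z s) /\
    `|w1 z s - w1 x t| <= e.
  move=> zx; split; first exact: (dw z s (le_lt_trans zx yd1) sd1).
  by rewrite distrC; exact: (c z s (le_lt_trans zx yd2) sd2).
suff [c0 [e1 ce]] : exists c0, w y s - w x s = w1 c0 s * (y - x) /\ `|w1 c0 s - w1 x t| <= e.
  by rewrite e1 -mulrBl normrM ler_wpM2r.
have [xy|yx|exy] := ltgtP x y.
- have [z|c0 /andP[xc cy] ->] := @mean_value R (w ^~ s) (w1 ^~ s) x y xy.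
    move=> /andP[xz zy]; apply: (box z _).1.
    by rewrite !ger0_norm ?subr_ge0 ?(ltW xy)// lerD2r.
  exists c0; split => //; apply: (box c0 _).2.
  by rewrite !ger0_norm ?subr_ge0 ?(ltW xc) ?(ltW xy)// lerD2r ltW.
- have [z|c0 /andP[xc cy] ee] := @mean_value R (w ^~ s) (w1 ^~ s) y x yx.
    move=> /andP[xz zy]; apply: (box z _).1.
    by rewrite !ler0_norm ?subr_le0 ?(ltW yx)// lerN2 lerD2r.
  exists c0; split; first by rewrite -opprB ee; ring.
  apply: (box c0 _).2.
  by rewrite !ler0_norm ?subr_le0 ?(ltW cy) ?(ltW yx)// lerN2 lerD2r ltW.
- exists x; rewrite -exy !subrr mulr0; split => //.
  by apply: (box x _).2; rewrite subrr normr0.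
Qed.

Lemma is_derive_along w (w1 : R -> R -> R) a X t X' :
  (\forall p \near (X t, t), is_derive (p.1 : R) 1 (w ^~ p.2) (w1 p.1 p.2)) ->
  {for (X t, t), continuous (fun p : R * R => w1 p.1 p.2)} ->
  is_derive t 1 (w (X t)) a -> is_derive t 1 X X' ->
  is_derive t 1 (fun s => w (X s) s) (w1 (X t) t * X' + a).
Proof.
move=> dw cw1 /is_deriveP dt dX; have cX := is_derive_continuous dX.
move/is_deriveP in dX.
have slope := partial_slope dw cw1.
set x := X t; set k := w1 x t; apply/is_deriveP => e e0.
pose e1 := e / (3 * (`|X'| + 1)); pose e2 := Num.min 1 (e / (3 * (`|k| + 1))).
have e10 : 0 < e1 by rewrite divr_gt0// mulr_gt0// ltr_wpDl.
have e20 : 0 < e2 by rewrite lt_min ltr01 divr_gt0// mulr_gt0// ltr_wpDl.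
have e30 : 0 < e / 3 by rewrite divr_gt0.
have /near_pairP[d d0 sl] := slope _ e10.
near=> s.
have h1 : `|w (X s) s - w x s - k * (X s - x)| <= e1 * `|X s - x|.
  apply: sl; last by near: s; exact: near_dist_lt.
  near: s; have /near_distP [r r0 hr] := @near_dist_lt R x _ d0.
  by move/cvgrPdist_lt : cX => /(_ _ d0); apply: filterS => z; rewrite distrC.
have h2 : `|w x s - w x t - a * (s - t)| <= e / 3 * `|s - t|.
  by near: s; exact: dt.
have h3 : `|X s - x - X' * (s - t)| <= e2 * `|s - t| by near: s; exact: dX.
set D := `|s - t| in h2 h3 *.
have D0 : 0 <= D by rewrite /D.
have h4 : `|X s - x| <= (`|X'| + 1) * D.
  rewrite -[X s - x](subrK (X' * (s - t))); apply: le_trans (ler_normD _ _) _.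
  rewrite mulrDl mul1r addrC normrM lerD//; apply: le_trans h3 _.
  by rewrite ler_piMl// /e2 ge_min lexx.
(* The path goes from (X s, s) at fixed time to (x, s), then at fixed place to (x, t); the last term
   linearizes X s - x. *)
have -> : w (X s) s - w x t - (k * X' + a) * (s - t) =
   (w (X s) s - w x s - k * (X s - x)) + ((w x s - w x t - a * (s - t)) + k * (X s - x - X' * (s - t))).
  by ring.
apply: le_trans (ler_normD _ _) _; apply: le_trans (lerD (lexx _) (ler_normD _ _)) _.
have -> : e * D = e / 3 * D + (e / 3 * D + e / 3 * D) by field.
apply: lerD; last apply: lerD => //.
- apply: le_trans h1 _; apply: le_trans (ler_wpM2l (ltW e10) h4) _.
  by rewrite mulrA ler_wpM2r// /e1 le_eqVlt; apply/orP; left; apply/eqP; field; rewrite gt_eqF// ltr_wpDl.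
- rewrite normrM; apply: le_trans (ler_wpM2l (normr_ge0 _) h3) _.
  rewrite mulrA ler_wpM2r//.
  apply: (@le_trans _ _ ((`|k| + 1) * (e / (3 * (`|k| + 1))))).
    by rewrite ler_pM// ?(ltW e20) ?lerDl// /e2 ge_min lexx orbT.
  by rewrite le_eqVlt; apply/orP; left; apply/eqP; field; rewrite gt_eqF// ltr_wpDl.
Unshelve. all: by end_near. Qed.

Lemma caloric_along (w : nat -> R -> R -> R) X t X' :
  (\forall p \near (X t, t), caloric_at w p.1 p.2) -> is_derive t 1 X X' ->
  forall j, is_derive t 1 (fun s => w j (X s) s) (w j.+1 (X t) t * X' + w j.+2 (X t) t).
Proof.
move=> cw dX j; have [_ h2 _] := nbhs_singleton cw j.
have [_ _ h3] := nbhs_singleton cw j.+1.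
apply: is_derive_along => //; apply: filterS cw => p /(_ j); by case.
Qed.

End ChainRule.

(** * Heat kernel and travelling waves *)

Section HeatKernel.
Context {R : realType}.
Implicit Types (x t v : R).

(* The Hermite recursion for the derivatives of the heat kernel. *)
Fixpoint heat (j : nat) (x t : R) : R :=
  match j with
  | 0 => if 0 < t then bell_weight / Num.sqrt t * expR (- (x ^+ 2 / (4 * t))) else 0
  | i.+1 => - (x * heat i x t + (if i is k.+1 then i%:R * heat k x t else 0)) / (2 * t)
  end.

Arguments heat : simpl never.

Lemma heatS j x t :
  heat j.+1 x t = - (x * heat j x t + j%:R * heat j.-1 x t) / (2 * t).
Proof. by rewrite /heat; case: j => [|j] //=; rewrite mul0r. Qed.

Lemma heat0E x t : 0 < t ->
  heat 0 x t = bell_weight / Num.sqrt t * expR (- (x ^+ 2 / (4 * t))).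
Proof. by rewrite /heat => ->. Qed.

Lemma heat_le0 j x t : t <= 0 -> heat j x t = 0.
Proof.
move=> t0; elim/ltn_ind: j => -[_|j ih]; first by rewrite /heat ltNge t0.
rewrite heatS !ih ?mulr0 ?addr0 ?oppr0 ?mul0r//.
by rewrite (leq_ltn_trans (leq_pred _)).
Qed.

Lemma flat_heat j : flat (heat j).
Proof.
elim/ltn_ind: j => -[_|j ih].
  (* For every t > 0, 1 / sqrt t <= 1 / t + 1, and this majorant is built from operations that
     preserve flatness. *)
  apply: (@flat_le _ _ (fun x t => bell_weight * (expR (- (x ^+ 2 / (4 * t))) / t) + bell_weight * expR (- (x ^+ 2 / (4 * t))))).
    apply: flatD; apply: flatZ; last exact: flat_exp.
    by apply: flat_divt; exact: flat_exp.
  have wb : 0 <= bell_weight :> R by rewrite ltW// bell_weight_gt0.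
  move=> x t x0 t0; rewrite heat0E// !ger0_norm; last 2 first.
  - by apply: addr_ge0; apply: mulr_ge0 => //; rewrite ?divr_ge0 ?expR_ge0 ?(ltW t0).
  - by apply: mulr_ge0; [apply: divr_ge0|]; rewrite // ?expR_ge0 ?sqrtr_ge0.
  rewrite mulrAC -mulrA -mulrDr ler_wpM2l ?wb//.
  rewrite -[leLHS]/(_ / _) -{1}[expR _]mulr1 -mulrA -[in leRHS](mulr1 (expR _)) -mulrA -mulrDr.
  rewrite ler_wpM2l ?expR_ge0// !mul1r.
  have [t1|t1] := leP t 1.
    apply: (@le_trans _ _ t^-1); last by rewrite lerDl.
    rewrite lef_pV2 ?posrE ?sqrtr_gt0//.
    have s1 : Num.sqrt t <= 1 by rewrite -sqrtr1 ler_sqrt.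
    have := sqr_sqrtr (ltW t0); have := sqrtr_ge0 t; nra.
  apply: (@le_trans _ _ 1); last by rewrite lerDr invr_ge0 ltW.
  by rewrite invf_le1 ?sqrtr_gt0// -sqrtr1 ler_sqrt// ltW.
have -> : heat j.+1 = (fun x t => (- 2^-1) * (x * heat j x t + j%:R * heat j.-1 x t) / t).
  apply/funext => x; apply/funext => t; rewrite heatS.
  by rewrite invfM !mulNr mulrA [_ * 2^-1]mulrC.
apply: flat_divt; apply: flatZ; apply: flatD; first by apply: flat_xM; apply: ih.
by apply: flatZ; apply: ih; rewrite (leq_ltn_trans (leq_pred _)).
Qed.

Lemma is_derive_heat_x j x t : 0 < t -> is_derive x 1 (heat j ^~ t) (heat j.+1 x t).
Proof.
(* The recursion has two steps, so the induction carries [j] and [j.-1] together; where the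
   predecessor is clamped at 0, its coefficient [j%:R] vanishes. *)
move=> t0; suff : is_derive x 1 (heat j ^~ t) (heat j.+1 x t) /\
    is_derive x 1 (heat j.-1 ^~ t) (heat j.-1.+1 x t) by case.
have t20 : t != 0 by rewrite gt_eqF.
elim: j => [|j [h1 h2]].
  suff : is_derive x 1 (heat 0 ^~ t) (heat 1 x t) by [].
  have -> : heat 0 ^~ t = (fun x => bell_weight / Num.sqrt t * expR (- (x ^+ 2 / (4 * t)))).
    by apply/funext => y; rewrite heat0E.
  apply: is_derive_eq; rewrite heatS heat0E// /GRing.scale /= mul0r addr0; field.
  by rewrite t20 gt_eqF// sqrtr_gt0.
split=> //; have -> : heat j.+1 ^~ t =
    (fun x => - (x * heat j x t + j%:R * heat j.-1 x t) / (2 * t)).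
  by apply/funext => y; rewrite heatS.
apply: is_derive_eq; rewrite [heat j.+2 x t]heatS /= /GRing.scale /=.
have -> : j%:R * heat j.-1.+1 x t = j%:R * heat j x t.
  by case: j {h1 h2} => [|j]; rewrite ?mul0r.
by rewrite -natr1; field.
Qed.

Lemma is_derive_heat_t j x t : 0 < t -> is_derive t 1 (heat j x) (heat j.+2 x t).
Proof.
move=> t0; suff : is_derive t 1 (heat j x) (heat j.+2 x t) /\
    is_derive t 1 (heat j.-1 x) (heat j.-1.+2 x t) by case.
have t20 : t != 0 by rewrite gt_eqF.
elim: j => [|j [h1 h2]].
  suff : is_derive t 1 (heat 0 x) (heat 2 x t) by [].
  apply: (@near_eq_is_derive _ _ _ (fun t => bell_weight / Num.sqrt t * expR (- (x ^+ 2 / (4 * t))))).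
    near=> s; rewrite heat0E//; near: s; exact: lt_nbhsr.
  have := is_derive1_sqrt t0 => ?.
  have s0 : 0 < Num.sqrt t by rewrite sqrtr_gt0.
  have s1 : Num.sqrt t != 0 by rewrite gt_eqF.
  have t4 : 4 * t != 0 by rewrite mulf_neq0// pnatr_eq0.
  apply: is_derive_eq; rewrite !heatS heat0E// /GRing.scale /=.
  have -> : t = Num.sqrt t ^+ 2 by rewrite sqr_sqrtr// ltW.
  by rewrite sqrtr_sqr gtr0_norm//; field; exact: s1.
split=> //; have -> : heat j.+1 x =
    (fun t => - (x * heat j x t + j%:R * heat j.-1 x t) / (2 * t)).
  by apply/funext => y; rewrite heatS.
have t4 : 2 * t != 0 by rewrite mulf_neq0// pnatr_eq0.
apply: is_derive_eq; rewrite [heat j.+3 x t]heatS /= /GRing.scale /=.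
have -> : j%:R * heat j.-1.+2 x t = j%:R * heat j.+1 x t.
  by case: j {h1 h2} => [|j]; rewrite ?mul0r.
have -> : x * heat j x t + j%:R * heat j.-1 x t = - (2 * t) * heat j.+1 x t.
  by rewrite heatS; field.
by rewrite -!natr1; field.
Unshelve. all: by end_near. Qed.

Lemma continuous_heat j x t : 0 < t ->
  {for (x, t), continuous (fun p : R * R => heat j p.1 p.2)}.
Proof.
move=> t0; have t20 : t != 0 by rewrite gt_eqF.
have t4 : 4 * t != 0 by rewrite mulf_neq0// pnatr_eq0.
have t2 : 2 * t != 0 by rewrite mulf_neq0// pnatr_eq0.
suff : {for (x, t), continuous (fun p : R * R => heat j p.1 p.2)} /\
    {for (x, t), continuous (fun p : R * R => heat j.-1 p.1 p.2)} by case.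
have c1 : (p.1 @[p --> (x, t)]) --> x by exact: cvg_fst.
have c2 : (p.2 @[p --> (x, t)]) --> t by exact: cvg_snd.
elim: j => [|j [h1 h2]].
  suff : {for (x, t), continuous (fun p : R * R => heat 0 p.1 p.2)} by [].
  rewrite /prop_for /continuous_at heat0E//=.
  have h0 : - (p.1 ^+ 2 / (4 * p.2)) @[p --> (x, t)] --> - (x ^+ 2 / (4 * t)).
    apply: cvgN; apply: cvgM; first exact: (cvgM c1 c1).
    by apply: cvgV => //; apply: cvgM => //; exact: cvg_cst.
  have h : (bell_weight / Num.sqrt p.2 * expR (- (p.1 ^+ 2 / (4 * p.2)))) @[p --> (x, t)]
      --> bell_weight / Num.sqrt t * expR (- (x ^+ 2 / (4 * t))).
    apply: cvgM; last by apply: (cvg_comp _ _ h0); exact: continuous_expR.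
    apply: cvgM; first exact: cvg_cst.
    apply: cvgV; first by rewrite gt_eqF// sqrtr_gt0.
    by apply: (cvg_comp _ _ c2); exact: sqrt_continuous.
  apply: cvg_trans h; apply: near_eq_cvg.
  by apply: filterS (@near_snd _ x t (fun s => 0 < s) (lt_nbhsr t0)) => p /= p0; rewrite heat0E.
split=> //; have -> : (fun p : R * R => heat j.+1 p.1 p.2) =
    (fun p => - (p.1 * heat j p.1 p.2 + j%:R * heat j.-1 p.1 p.2) / (2 * p.2)).
  by apply/funext => y; rewrite heatS.
apply: cvgM.
  apply: cvgN; apply: cvgD; first by apply: cvgM.
  by apply: cvgM => //; exact: cvg_cst.
by apply: cvgV => //; apply: cvgM => //; exact: cvg_cst.
Qed.

Lemma caloric_heat x t : t != 0 \/ 0 < x -> caloric_at heat x t.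
Proof.
apply: caloric_extend.
- exact: heat_le0.
- by move=> y s s0 j; split;
    [exact: is_derive_heat_x|exact: is_derive_heat_t|exact: continuous_heat].
- exact: flat_heat.
Qed.

End HeatKernel.

(** * The error-function step and its Galilean boost *)

Section StepAndWave.
Context {R : realType}.
Implicit Types (x t v : R).

(** Self-similar solution with data 1 on x < 0 and 0 on x > 0. Extended by 0 to [t <= 0] it stays
    caloric across t = 0 where x > 0, the side that is kept ahead of the front. *)
Definition step (j : nat) (x t : R) : R :=
  if j is i.+1 then - heat i x t else if 0 < t then tail (x / Num.sqrt t) else 0.

Arguments step : simpl never.

Lemma stepS j x t : step j.+1 x t = - heat j x t. Proof. by []. Qed.

Lemma step0E x t : 0 < t -> step 0 x t = tail (x / Num.sqrt t).
Proof. by rewrite /step => ->. Qed.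

Lemma step_le0 j x t : t <= 0 -> step j x t = 0.
Proof. by move=> t0; case: j => [|j]; rewrite ?stepS ?heat_le0 ?oppr0// /step ltNge t0. Qed.

Lemma bell_sqrt x t : 0 < t -> bell (x / Num.sqrt t) = expR (- (x ^+ 2 / (4 * t))).
Proof.
move=> t0; rewrite /bell expr_div_n sqr_sqrtr ?ltW//; congr (expR (- _)).
by field; rewrite gt_eqF.
Qed.

Lemma step_ge0 x t : 0 <= step 0 x t.
Proof. by rewrite /step; case: ifP => // _; exact: tail_ge0. Qed.

Lemma step_le1 x t : step 0 x t <= 1.
Proof. by rewrite /step; case: ifP => // _; exact: tail_le1. Qed.

Lemma step_le_exp x t : 0 <= x -> 0 < t -> step 0 x t <= expR (- (x ^+ 2 / (4 * t))).
Proof.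
move=> x0 t0; rewrite step0E// -bell_sqrt// tail_le_bell//.
by rewrite divr_ge0// sqrtr_ge0.
Qed.

Lemma step_ge_half x t : x <= 0 -> 0 < t -> 2^-1 <= step 0 x t.
Proof.
move=> x0 t0; rewrite step0E// tail_ge_half//.
by rewrite pmulr_lle0 ?invr_gt0 ?sqrtr_gt0.
Qed.

Lemma stepN x t : 0 < t -> step 0 (- x) t = 1 - step 0 x t.
Proof. by move=> t0; rewrite !step0E// mulNr tailN. Qed.

Lemma flat_step j : flat (step j).
Proof.
case: j => [|j].
  apply: (flat_le flat_exp) => x t x0 t0.
  by rewrite !ger0_norm ?expR_ge0 ?step_ge0// step_le_exp// ltW.
have -> : step j.+1 = (fun x t => (-1) * heat j x t).
  by apply/funext => x; apply/funext => t; rewrite stepS mulN1r.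
by apply: flatZ; exact: flat_heat.
Qed.

Lemma continuous_tail : continuous (@tail R).
Proof. by move=> x; apply: is_derive_continuous; exact: is_derive_tail. Qed.

Lemma caloric_step x t : t != 0 \/ 0 < x -> caloric_at step x t.
Proof.
apply: caloric_extend; [exact: step_le0| |exact: flat_step].
move=> {}x {}t t0; have s0 : 0 < Num.sqrt t by rewrite sqrtr_gt0.
have s1 : Num.sqrt t != 0 by rewrite gt_eqF.
case=> [|j]; last first.
  have [? ? ?] := caloric_heat (or_introl (lt0r_neq0 t0) : t != 0 \/ 0 < x) j.
  by split; [exact: is_deriveN|exact: is_deriveN|exact: cvgN].
split.
- have -> : step 0 ^~ t = tail \o (fun x => x / Num.sqrt t).
    by apply/funext => y; rewrite step0E.
  have := is_derive_tail (x / Num.sqrt t) => ?.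
  have h : is_derive x 1 (fun x => x / Num.sqrt t) (Num.sqrt t)^-1.
    by apply: (@is_derive_affine _ _ _ 0) => y; rewrite add0r mulrC.
  have := @is_derive1_comp R tail (fun x => x / Num.sqrt t) x _ _ (is_derive_tail (x / Num.sqrt t)) h.
  by rewrite bell_sqrt// stepS heat0E// mulNr mulrAC.
- apply: (@near_eq_is_derive _ _ _ (tail \o (fun t => x / Num.sqrt t))).
    near=> s; rewrite step0E//; near: s; exact: lt_nbhsr.
  have := is_derive1_sqrt t0 => ?.
  have h : is_derive t 1 (fun t => x / Num.sqrt t) (- (x / (2 * t * Num.sqrt t))).
    apply: is_derive_eq; rewrite /GRing.scale /=.
    have -> : t = Num.sqrt t ^+ 2 by rewrite sqr_sqrtr// ltW.
    by rewrite sqrtr_sqr gtr0_norm//; field.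
  have := @is_derive1_comp R tail (fun t => x / Num.sqrt t) t _ _ (is_derive_tail (x / Num.sqrt t)) h.
  rewrite bell_sqrt// stepS heatS heat0E//; congr is_derive.
  by field; rewrite s1 gt_eqF.
- have c1 : (p.1 @[p --> (x, t)]) --> x by exact: cvg_fst.
  have c2 : (p.2 @[p --> (x, t)]) --> t by exact: cvg_snd.
  rewrite /prop_for /continuous_at step0E//.
  have h0 : p.1 / Num.sqrt p.2 @[p --> (x, t)] --> x / Num.sqrt t.
    apply: cvgM => //; apply: cvgV => //.
    by apply: (cvg_comp _ _ c2); exact: sqrt_continuous.
  have h : tail (p.1 / Num.sqrt p.2) @[p --> (x, t)] --> tail (x / Num.sqrt t).
    by apply: (cvg_comp _ _ h0); exact: continuous_tail.
  apply: cvg_trans h; apply: near_eq_cvg.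
  by apply: filterS (@near_snd _ x t (fun s => 0 < s) (lt_nbhsr t0)) => p p0; rewrite step0E.
Unshelve. all: by end_near. Qed.

(* [wave v] is the Galilean boost of [step]: for large t it is close to the
   travelling wave exp (- v (x - v t)) near x = v t. *)
Fixpoint wave v (j : nat) (x t : R) : R :=
  if j is i.+1 then - (v * wave v i x t + heat i x t)
  else expR (v ^+ 2 * t - v * x) * step 0 (x - 2 * v * t) t.

Arguments wave : simpl never.

Lemma wave0E v x t :
  wave v 0 x t = expR (v ^+ 2 * t - v * x) * step 0 (x - 2 * v * t) t.
Proof. by []. Qed.

Lemma waveS v j x t : wave v j.+1 x t = - (v * wave v j x t + heat j x t).
Proof. by []. Qed.

Lemma wave_le0 v j x t : t <= 0 -> wave v j x t = 0.
Proof.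
move=> t0; elim: j => [|j ih]; first by rewrite wave0E step_le0// mulr0.
by rewrite waveS ih heat_le0// mulr0 addr0 oppr0.
Qed.

Lemma wave_ge0 v x t : 0 <= wave v 0 x t.
Proof. by rewrite wave0E mulr_ge0 ?expR_ge0 ?step_ge0. Qed.

(** Completing the square. Because the boosted kernel is the kernel itself, differentiating [wave v]
    produces only [wave v] and [heat], never a shifted kernel. *)
Lemma heat_boost v x t : 0 < t ->
  expR (v ^+ 2 * t - v * x) * heat 0 (x - 2 * v * t) t = heat 0 x t.
Proof.
move=> t0; rewrite !heat0E// mulrCA -expRD; congr (_ * expR _).
by field; rewrite gt_eqF.
Qed.

Lemma flat_wave v j : 0 < v -> flat (wave v j).
Proof.
move=> v0; elim: j => [|j ih].
  move=> a m k a0; have [C hC] := @flat_exp R (a / 2) (m / 2) k (divr_gt0 a0 (ltr0n _ 2)).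
  exists (expR (v ^+ 2) * (`|C| + (4 * v / a) ^+ k)) => x t /andP[ax xm] /andP[t0 t1].
  have x0 := lt_le_trans a0 ax.
  rewrite ger0_norm ?wave_ge0// wave0E -[leRHS]mulrA ler_pM ?expR_ge0 ?step_ge0//.
    rewrite ler_expR lerBlDr; apply: (@le_trans _ _ (v ^+ 2)).
      by rewrite ler_piMr// sqr_ge0.
    by rewrite lerDl mulr_ge0// ltW.
  (* Up to time a / (4 v) the boosted argument x - 2 v t is at least x / 2 and the Gaussian bound
     applies; after it t is bounded below, and 1 <= (4 v t / a)^k. *)
  rewrite [leRHS]mulrDl; have [ta|ta] := leP t (a / (4 * v)).
    apply: (@le_trans _ _ (`|C| * t ^+ k)); last first.
      by rewrite lerDl; apply: mulr_ge0; apply: exprn_ge0; [apply: divr_ge0; lra|exact: ltW].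
    have xt : 2 * v * t <= x / 2.
      move: ta; rewrite ler_pdivlMr ?mulr_gt0//; lra.
    apply: le_trans (step_le_exp _ t0) _; first lra.
    apply: (@le_trans _ _ (expR (- ((x / 2) ^+ 2 / (4 * t))))).
      rewrite ler_expR lerN2 ler_pM2r ?invr_gt0 ?mulr_gt0//.
      by apply: lerXn2r; rewrite ?nnegrE; lra.
    have := hC (x / 2) t; rewrite ger0_norm ?expR_ge0// => h.
    apply: le_trans (h _ _) _; [lra|by rewrite t0|].
    by rewrite ler_wpM2r ?ler_norm// exprn_ge0// ltW.
  apply: (le_trans (step_le1 _ _)).
  apply: (@le_trans _ _ ((4 * v / a) ^+ k * t ^+ k)); last first.
    by rewrite lerDr mulr_ge0// exprn_ge0// ltW.
  rewrite -exprMn exprn_ege1//; move: ta; rewrite ltr_pdivrMr ?mulr_gt0// => ta.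
  by rewrite mulrAC ler_pdivlMr//; lra.
have -> : wave v j.+1 = (fun x t => (-1) * (v * wave v j x t + heat j x t)).
  by apply/funext => x; apply/funext => t; rewrite waveS mulN1r.
by apply: flatZ; apply: flatD; [exact: flatZ|exact: flat_heat].
Qed.

Lemma caloric_wave v x t : 0 < v -> t != 0 \/ 0 < x -> caloric_at (wave v) x t.
Proof.
move=> v0; apply: caloric_extend; [exact: wave_le0| |by move=> j; exact: flat_wave].
move=> {}x {}t t0; have tx (y : R) : t != 0 \/ 0 < y by left; rewrite gt_eqF.
elim=> [|j ih]; last first.
  have [h1 h2 h3] := ih; have [k1 k2 k3] := caloric_heat (tx x) j; split.
  - have -> : (wave v j.+1)^~ t = (fun y => - (v * wave v j y t + heat j y t)) by [].
    by apply: is_derive_eq; rewrite /GRing.scale.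
  - have -> : wave v j.+1 x = (fun s => - (v * wave v j x s + heat j x s)) by [].
    by apply: is_derive_eq; rewrite /GRing.scale.
  - have -> : (fun p : R * R => wave v j.+1 p.1 p.2) =
      (fun p => - (v * wave v j p.1 p.2 + heat j p.1 p.2)) by [].
    by apply: cvgN; apply: cvgD => //; apply: cvgMr.
pose y := x - 2 * v * t; have [d1 d2 d3] := caloric_step (tx y) 0.
split.
- have -> : (wave v 0)^~ t = (fun x => expR (v ^+ 2 * t - v * x)) * (step 0 ^~ t \o shift (- (2 * v * t))).
    by apply/funext => z.
  have ? := is_derive_shift x 1 (- (2 * v * t)).
  have ? : is_derive x 1 (step 0 ^~ t \o shift (- (2 * v * t))) (step 1 y t * 1).
    exact: is_derive1_comp.
  apply: is_derive_eq; rewrite /GRing.scale /= waveS wave0E stepS.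
  by rewrite -(heat_boost v x t0) -/y; ring.
- have ? : is_derive t 1 (fun s => step 0 (x - 2 * v * s) s) (step 1 y t * (- (2 * v)) + step 2 y t).
    apply: (@caloric_along _ step (fun s => x - 2 * v * s) t (- (2 * v)) _ _ 0).
      apply: filterS (@near_snd _ _ t _ (lt_nbhsr t0)) => p p0.
      by apply: caloric_step; left; rewrite gt_eqF.
    by apply: (@is_derive_affine _ _ _ x) => s; rewrite mulNr.
  have -> : wave v 0 x = (fun s => expR (v ^+ 2 * s - v * x)) * (fun s => step 0 (x - 2 * v * s) s).
    by apply/funext => z.
  apply: is_derive_eq; rewrite /GRing.scale /= !waveS wave0E !stepS !heatS -(heat_boost v x t0) -/y.
  rewrite /y; field; by rewrite gt_eqF.
- have c1 : (p.1 @[p --> (x, t)]) --> x by exact: cvg_fst.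
  have c2 : (p.2 @[p --> (x, t)]) --> t by exact: cvg_snd.
  have cc (k : R) : (k * p.2) @[p --> (x, t)] --> k * t by apply: cvgM => //; exact: cvg_cst.
  rewrite /prop_for /continuous_at wave0E.
  have h0 : v ^+ 2 * p.2 - v * p.1 @[p --> (x, t)] --> v ^+ 2 * t - v * x.
    by apply: cvgB => //; apply: cvgM => //; exact: cvg_cst.
  apply: cvgM; first by apply: (cvg_comp _ _ h0); exact: continuous_expR.
  have h1 : p.1 - 2 * v * p.2 @[p --> (x, t)] --> y by apply: cvgB.
  move=> U /d3 /near_pairP[e e0 hU].
  move/cvgrPdist_lt : h1 => /(_ _ e0).
  have := near_snd x (near_dist_lt t e0); apply: filterS2 => p p1 p2.
  by apply: (hU (p.1 - 2 * v * p.2)) => //; rewrite distrC.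
Qed.

End StepAndWave.

Arguments step : simpl never.
Arguments wave : simpl never.

Opaque heat step wave bell_weight.

(** * Stopped waves *)

Section Profile.
Context {R : realType}.
Implicit Types (x t v T X tau : R).

Local Notation w := (@bell_weight R).
Let w_ge0 : 0 <= w. Proof. by rewrite ltW// bell_weight_gt0. Qed.

Lemma heat_ge0 x t : 0 <= heat 0 x t.
Proof.
have [t0|t0] := ltP 0 t; last by rewrite heat_le0.
by rewrite heat0E// mulr_ge0 ?expR_ge0// divr_ge0 ?sqrtr_ge0.
Qed.

Lemma heat1E x t : heat 1 x t = - (x / (2 * t) * heat 0 x t).
Proof. by rewrite heatS mul0r addr0 mulNr mulrAC. Qed.

Lemma heat2E x t : 0 < t -> heat 2 x t = (x ^+ 2 - 2 * t) / (4 * t ^+ 2) * heat 0 x t.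
Proof. by move=> t0; rewrite !heatS; field; rewrite gt_eqF. Qed.

Lemma heat3E x t : 0 < t ->
  heat 3 x t = (6 * t * x - x ^+ 3) / (8 * t ^+ 3) * heat 0 x t.
Proof. by move=> t0; rewrite !heatS; field; rewrite gt_eqF. Qed.

Lemma heat1_le0 x t : 0 <= x -> 0 < t -> heat 1 x t <= 0.
Proof.
by move=> x0 t0; rewrite heat1E oppr_le0 mulr_ge0 ?heat_ge0 ?divr_ge0 ?mulr_ge0 ?(ltW t0).
Qed.

Lemma heat1_ge x t : 0 < t -> - heat 1 x t <= w / t.
Proof.
move=> t0; rewrite heat1E opprK heat0E//.
have s0 : 0 < Num.sqrt t by rewrite sqrtr_gt0.
have st : Num.sqrt t ^+ 2 = t by rewrite sqr_sqrtr// ltW.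
set s := Num.sqrt t in s0 st *; rewrite -st; clearbody s.
pose z := x / s; have -> : x = z * s by rewrite /z divfK// gt_eqF.
have -> : (z * s) ^+ 2 / (4 * s ^+ 2) = z ^+ 2 / 4 by field; rewrite gt_eqF.
rewrite expRN; set e := expR _.
have e0 : 0 < e by exact: expR_gt0.
have ze : z / 2 <= e by apply: le_trans (expR_ge1Dx _); have := sqr_ge0 (z - 1); lra.
have -> : z * s / (2 * s ^+ 2) * (bell_weight / s / e) = w / s ^+ 2 * (z / 2 / e).
  by field; rewrite !gt_eqF.
have ws : 0 <= w / s ^+ 2 by rewrite divr_ge0// sqr_ge0.
by apply: ler_piMr => //; rewrite ler_pdivrMr// mul1r.
Qed.

Definition heat3_bound : R := 12 ^+ 3 * bell_weight.
Local Notation K3 := heat3_bound.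

Lemma heat3_boundE : heat3_bound = 12 ^+ 3 * w. Proof. by []. Qed.

Lemma heat3_bound_ge0 : 0 <= heat3_bound.
Proof. by apply: mulr_ge0 => //; exact: exprn_ge0. Qed.

Opaque heat3_bound.

(** The weight (sqrt t + x)^(-2) is made to be integrated along a line of slope [v], where it yields
    a factor 1 / v. The proof rescales to z = x / sqrt t. *)
Lemma heat3_le x t : 0 <= x -> 0 < t ->
  `|heat 3 x t| <= heat3_bound / (t * (Num.sqrt t + x) ^+ 2).
Proof.
move=> x0 t0; rewrite heat3E// heat0E//.
have s0 : 0 < Num.sqrt t by rewrite sqrtr_gt0.
have st : Num.sqrt t ^+ 2 = t by rewrite sqr_sqrtr// ltW.
set s := Num.sqrt t in s0 st *; rewrite -st; clearbody s.
have sn : s != 0 by rewrite gt_eqF.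
pose z := x / s; have xE : x = z * s by rewrite /z divfK.
have z0 : 0 <= z by rewrite /z divr_ge0// ltW.
rewrite xE; clearbody z.
have -> : (z * s) ^+ 2 / (4 * s ^+ 2) = z ^+ 2 / 4 by field.
rewrite expRN; set e := expR _.
have e0 : 0 < e by exact: expR_gt0.
have en : e != 0 by rewrite gt_eqF.
have z1 : 1 + z != 0 by rewrite gt_eqF// ltr_pwDl.
(* Cube of exp (z^2 / 12) >= 1 + z^2 / 12 >= (1 + z^2) / 12; this is the origin of 12^3 in
   [heat3_bound]. *)
have ez : (1 + z ^+ 2) ^+ 3 <= 12 ^+ 3 * e.
  have -> : 12 ^+ 3 * e = (12 * expR (z ^+ 2 / 4 / 3%:R)) ^+ 3.
    by rewrite exprMn -expRM_natl /e; congr (_ * expR _); field.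
  apply: lerXn2r; rewrite ?nnegrE ?mulr_ge0 ?expR_ge0 ?addr_ge0 ?sqr_ge0//.
  have := expR_ge1Dx (z ^+ 2 / 4 / 3%:R); have := sqr_ge0 z; lra.
have -> : (6 * s ^+ 2 * (z * s) - (z * s) ^+ 3) / (8 * (s ^+ 2) ^+ 3) * (bell_weight / s / e)
   = w / (s ^+ 4 * (1 + z) ^+ 2 * e) * ((6 * z - z ^+ 3) / 8 * (1 + z) ^+ 2).
  by field; rewrite sn en z1.
have -> : heat3_bound / (s ^+ 2 * (s + z * s) ^+ 2) = w / (s ^+ 4 * (1 + z) ^+ 2 * e) * (12 ^+ 3 * e).
  rewrite heat3_boundE; field; rewrite sn en z1 /=.
  by have -> : s + z * s = (1 + z) * s; [ring|rewrite mulf_neq0].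
rewrite normrM ger0_norm; last first.
  by rewrite divr_ge0// !mulr_ge0 ?sqr_ge0 ?exprn_ge0 ?(ltW s0) ?(ltW e0) ?addr_ge0.
rewrite ler_wpM2l//.
  by rewrite divr_ge0// !mulr_ge0 ?sqr_ge0 ?exprn_ge0 ?(ltW s0) ?(ltW e0) ?addr_ge0.
apply: le_trans ez; rewrite normrM [X in _ * X]ger0_norm ?sqr_ge0//.
have h1 : `|(6 * z - z ^+ 3) / 8| <= (1 + z ^+ 2) * (1 + z ^+ 2) / 2.
  have z3 : 0 <= z ^+ 3 by exact: exprn_ge0.
  have z4 : 0 <= (z ^+ 2 - z) ^+ 2 by exact: sqr_ge0.
  have z5 : 0 <= (z - 1) ^+ 2 by exact: sqr_ge0.
  rewrite ler_norml; apply/andP; split; nra.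
have h2 : (1 + z) ^+ 2 <= 2 * (1 + z ^+ 2) by have := sqr_ge0 (z - 1); lra.
apply: le_trans (ler_pM _ _ h1 h2) _ => //; first exact: sqr_ge0.
by rewrite le_eqVlt; apply/orP; left; apply/eqP; field.
Qed.

Lemma is_derive_line (f : nat -> R -> R -> R) v X tau (s : R) :
  (forall x t, 0 < t -> caloric_at f x t) -> 0 < tau -> 0 <= s ->
  forall j, is_derive s 1 (fun s => f j (X + v * s) (tau + s))
   (f j.+1 (X + v * s) (tau + s) * v + f j.+2 (X + v * s) (tau + s)).
Proof.
move=> cf tau0 s0 j; have ts : 0 < tau + s by rewrite ltr_wpDr.
pose g := fun y : R => X + v * (y - tau).
have e y : g (y + tau) = X + v * y by rewrite /g addrK.
have : is_derive (tau + s) 1 (fun y => f j (g y) y) (f j.+1 (g (tau + s)) (tau + s) * v + f j.+2 (g (tau + s)) (tau + s)).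
  apply: caloric_along; last by apply: (@is_derive_affine _ _ _ (X - v * tau)) => y; rewrite /g; ring.
  by apply: filterS (@near_snd _ _ (tau + s) _ (lt_nbhsr ts)) => p; exact: cf.
have -> : tau + s = shift tau s by rewrite /= addrC.
move=> h; have ? := is_derive_shift s 1 tau.
have := @is_derive1_comp R _ (shift tau) s _ _ h _.
move/(_ 1 (is_derive_shift _ _ _)); rewrite mulr1 /= e.
suff -> : (fun r => f j (X + v * r) (tau + r)) = (fun y => f j (g y) y) \o shift tau by [].
by apply/funext => y /=; rewrite e [tau + y]addrC.
Qed.

Let heatP x t : 0 < t -> caloric_at heat x t.
Proof. by move=> t0; apply: caloric_heat; left; rewrite gt_eqF. Qed.

Variables (v T : R).
Hypothesis v0 : 0 < v.

Let waveP x t : 0 < t -> caloric_at (wave v) x t.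
Proof. by move=> t0; apply: caloric_wave => //; left; rewrite gt_eqF. Qed.

Lemma wave2E x t : wave v 2 x t = v ^+ 2 * wave v 0 x t + v * heat 0 x t - heat 1 x t.
Proof. by rewrite !waveS; ring. Qed.

Section AlongTheWave.
Variables (X tau : R).
Hypotheses (T0 : 0 <= T) (tau0 : 0 < tau).

(** Both values carry the same factor exp q, q = v^2 tau - v X. If q <= 0 this is at most 1; if q >
    0 the missing part of the step is a Gaussian tail, and the exponents add up to - X^2 / (4
    tau). *)
Lemma wave_sub_le1 : wave v 0 (X + v * T) (tau + T) - wave v 0 X tau <= 1.
Proof.
have tT : 0 < tau + T by rewrite ltr_wpDr.
rewrite !wave0E.
have -> : v ^+ 2 * (tau + T) - v * (X + v * T) = v ^+ 2 * tau - v * X by ring.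
set q := v ^+ 2 * tau - v * X; rewrite -mulrBr.
have s1 := step_le1 (X + v * T - 2 * v * (tau + T)) (tau + T).
have s2 := step_ge0 (X - 2 * v * tau) tau.
have [q0|q0] := leP q 0.
  apply: (@le_trans _ _ (expR q * 1)); last by rewrite mulr1 expR_le1.
  by rewrite ler_pM2l ?expR_gt0// lerBlDr (le_trans s1)// lerDl.
have Xv : X < v * tau.
  by move: q0; rewrite /q subr_gt0 expr2 -mulrA ltr_pM2l.
have := step_le_exp (x := 2 * v * tau - X) _ tau0.
have vt : 0 <= v * tau by rewrite mulr_ge0 ?(ltW v0) ?(ltW tau0).
have -> : X - 2 * v * tau = - (2 * v * tau - X) by ring.
rewrite stepN// => h.
have {}h : step 0 (2 * v * tau - X) tau <= expR (- ((2 * v * tau - X) ^+ 2 / (4 * tau))).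
  by apply: h; rewrite subr_ge0 -mulrA (le_trans (ltW Xv))// ler_peMl// ler1n.
apply: (@le_trans _ _ (expR q * expR (- ((2 * v * tau - X) ^+ 2 / (4 * tau))))).
  rewrite ler_pM2l ?expR_gt0//; apply: le_trans h.
  by rewrite opprB addrA lerBlDr [leLHS]addrC lerD2l.
rewrite -expRD expR_le1.
have -> : q - (2 * v * tau - X) ^+ 2 / (4 * tau) = - (X ^+ 2 / (4 * tau)).
  by rewrite /q; field; rewrite gt_eqF.
by rewrite oppr_le0 divr_ge0 ?sqr_ge0// mulr_ge0// ltW.
Qed.

Hypothesis X0 : 0 <= X.

Let pos s : 0 <= s <= T -> [/\ 0 <= s, 0 < tau + s, 0 <= X + v * s & tau <= tau + s].
Proof.
move=> /andP[s0 _]; have vs : 0 <= v * s by rewrite mulr_ge0// ltW.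
by split; rewrite ?lerDl// ?ltr_wpDr// addr_ge0.
Qed.

(** The derivative along a line of slope [v] is [- heat 1], which is nonnegative on x >= 0. *)
Lemma wave_le_along : wave v 0 X tau <= wave v 0 (X + v * T) (tau + T).
Proof.
have := @le_of_derive_ge0 R (fun s => wave v 0 (X + v * s) (tau + s))
  (fun s => - heat 1 (X + v * s) (tau + s)) 0 T T0.
rewrite mulr0 !addr0; apply => s /pos[s0 ts xs _]; last by rewrite oppr_ge0 heat1_le0.
have := @is_derive_line _ v X tau s waveP tau0 s0 0%N.
by congr is_derive; rewrite !waveS; ring.
Qed.

(* Along a line of slope v the derivative of wave v 2 is - heat 3, which does not
   involve v. *)
Lemma wave2_along : `|wave v 2 (X + v * T) (tau + T) - wave v 2 X tau|
  <= K3 / (v * tau * Num.sqrt tau).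
Proof.
pose r := Num.sqrt tau; have r0 : 0 < r by rewrite sqrtr_gt0.
have d s : 0 <= s <= T -> is_derive s 1 (fun s => wave v 2 (X + v * s) (tau + s))
   (- heat 3 (X + v * s) (tau + s)).
  move=> /pos[s0 _ _ _]; have := @is_derive_line _ v X tau s waveP tau0 s0 2%N.
  by congr is_derive; rewrite !waveS; ring.
(* Primitive of the majorant obtained from [heat3_le] on bounding tau + s below by tau, and sqrt
   (tau + s) + X + v s by r + v s. *)
pose g s := - (K3 / (v * tau) / (r + v * s)).
have dg s : 0 <= s <= T -> is_derive s 1 g (K3 / (tau * (r + v * s) ^+ 2)).
  move=> /pos[s0 _ _ _].
  have rs : r + v * s != 0 by rewrite gt_eqF// ltr_wpDr// mulr_ge0// ltW.
  have ? : is_derive s 1 (fun s => r + v * s) v by apply: is_derive_affine.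
  rewrite /g; apply: is_derive_eq; rewrite /GRing.scale /=; field.
  by rewrite rs !gt_eqF.
have hb s : 0 <= s <= T -> `|heat 3 (X + v * s) (tau + s)| <= K3 / (tau * (r + v * s) ^+ 2).
  move=> /pos[s0 ts xs tts]; apply: le_trans (heat3_le xs ts) _.
  have vs : 0 <= v * s by rewrite mulr_ge0// ltW.
  have a0 : 0 < tau * (r + v * s) ^+ 2.
    by apply: mulr_gt0 => //; apply: exprn_gt0; exact: ltr_wpDr.
  have ab : tau * (r + v * s) ^+ 2 <=
      (tau + s) * (Num.sqrt (tau + s) + (X + v * s)) ^+ 2.
    apply: ler_pM => //; [exact: ltW|exact: sqr_ge0|].
    have h : r + v * s <= Num.sqrt (tau + s) + (X + v * s).
      by apply: lerD; [rewrite ler_wsqrtr|rewrite lerDr].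
    have rs : 0 <= r + v * s by rewrite addr_ge0// ltW.
    by apply: lerXn2r; rewrite ?nnegrE// (le_trans rs).
  have cw : 0 <= K3 by exact: heat3_bound_ge0.
  by apply: ler_wpM2l => //; rewrite lef_pV2// posrE// (lt_le_trans a0).
have gT : g T - g 0 <= K3 / (v * tau * r).
  have rT : 0 < r + v * T by rewrite ltr_wpDr// mulr_ge0// ltW.
  have -> : K3 / (v * tau * r) = K3 / (v * tau) / r.
    by field; rewrite !gt_eqF.
  rewrite /g mulr0 addr0 opprK addrC gerBl.
  apply: divr_ge0; last exact: ltW.
  by apply: divr_ge0; [exact: heat3_bound_ge0|apply: mulr_ge0; exact: ltW].
have h1 := @sub_le_of_derive_le R _ g _ _ 0 T T0 d dg _.
have h2 := @sub_le_of_derive_le R (fun s => - wave v 2 (X + v * s) (tau + s)) g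
  (fun s => heat 3 (X + v * s) (tau + s)) _ 0 T T0 _ dg _.
rewrite mulr0 !addr0 in h1 h2; rewrite ler_norml; apply/andP; split.
  rewrite lerNl opprB; apply: le_trans gT.
  have <- : - wave v 2 (X + v * T) (tau + T) - - wave v 2 X tau =
    wave v 2 X tau - wave v 2 (X + v * T) (tau + T) by ring.
  apply: h2.
    by move=> s sT; rewrite -[heat 3 _ _]opprK; have := d s sT => ?; apply: is_deriveN.
  by move=> s /hb; apply: le_trans; exact: ler_norm.
apply: le_trans gT; apply: h1 => s /hb; apply: le_trans.
by rewrite -normrN ler_norm.
Qed.

(** Adding [heat 1] turns the derivative along the line from [- heat 3] into [v * heat 2],
    nonnegative where x^2 >= 2 t. The line stays there because v X >= 1: (X + v s)^2 >= X^2 + 2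
    s. *)
Lemma wave2_along_ge : 2 * tau <= X ^+ 2 -> v^-1 <= X ->
  wave v 2 X tau + heat 1 X tau <=
  wave v 2 (X + v * T) (tau + T) + heat 1 (X + v * T) (tau + T).
Proof.
move=> hX vX; have vX1 : 1 <= v * X by rewrite mulrC -ler_pdivrMr// mul1r.
have := @le_of_derive_ge0 R
  (fun s => wave v 2 (X + v * s) (tau + s) + heat 1 (X + v * s) (tau + s))
  (fun s => v * heat 2 (X + v * s) (tau + s)) 0 T T0.
rewrite mulr0 !addr0; apply => s /pos[s0 ts xs _].
  have d1 := @is_derive_line _ v X tau s waveP tau0 s0 2%N.
  have d2 := @is_derive_line _ v X tau s heatP tau0 s0 1%N.
  by have := is_deriveD d1 d2; congr is_derive; rewrite !waveS; ring.
rewrite mulr_ge0 ?(ltW v0)// heat2E// mulr_ge0 ?heat_ge0// divr_ge0 ?mulr_ge0 ?sqr_ge0 ?(ltW ts)//.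
have : 0 <= (v * s) ^+ 2 by exact: sqr_ge0.
rewrite subr_ge0; nra.
Qed.

End AlongTheWave.

(* Large enough for the stopping term to dominate the error in [wave2_along]. *)
Definition stop_weight : R := 4 * heat3_bound / bell_weight + 1.
Local Notation c := stop_weight.

Lemma stop_weightE : stop_weight = 4 * K3 / w + 1. Proof. by []. Qed.

Lemma stop_weight_ge1 : 1 <= stop_weight.
Proof.
rewrite /stop_weight lerDr divr_ge0// mulr_ge0//; exact: heat3_bound_ge0.
Qed.

Opaque stop_weight.

(* A wave of speed [v] launched at time 0 and stopped at time [T]: subtracting
   the wave relaunched from its position at time [T] cancels its growth, and the
   last term restores the sign of the time derivative. *)
Definition profile (j : nat) (x t : R) : R :=
  step j x t + wave v j x t
  - wave v j (x - v * T) (t - T) + c * step j (x - v * T) (t - T).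

Lemma caloric_profile x t : t != 0 \/ 0 < x -> t != T \/ v * T < x ->
  caloric_at profile x t.
Proof.
move=> h1 h2.
have h3 : t - T != 0 \/ 0 < x - v * T by rewrite subr_eq0 subr_gt0.
have := caloric_atD (caloric_atD (caloric_step h1) (caloric_wave v0 h1))
  (caloric_atD (caloric_atZ (-1) (caloric_at_shift (caloric_wave v0 h3)))
    (caloric_atZ c (caloric_at_shift (caloric_step h3)))).
congr caloric_at; apply/funext => j; apply/funext => y; apply/funext => s.
by rewrite /profile; ring.
Qed.

Lemma profile_le0 j x t : 0 <= T -> t <= 0 -> profile j x t = 0.
Proof.
move=> T0 t0; have tT : t - T <= 0 by lra.
by rewrite /profile !step_le0// !wave_le0// !mulr0 !addr0 subr0.
Qed.

Lemma profile_before j x t : t <= T -> profile j x t = step j x t + wave v j x t.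
Proof.
move=> tT; have tT' : t - T <= 0 by lra.
by rewrite /profile (step_le0 j _ tT') (wave_le0 v j _ tT') mulr0 addr0 subr0.
Qed.

Lemma profile0_ge0 x t : 0 <= T -> (T < t -> v * T <= x) -> 0 <= profile 0 x t.
Proof.
move=> T0 h; have [tT|Tt] := leP t T.
  by rewrite profile_before// addr_ge0 ?step_ge0 ?wave_ge0.
have := @wave_le_along (x - v * T) (t - T) T0; rewrite !subrK subr_ge0 subr_gt0.
move=> /(_ Tt (h Tt)) hw; have hs := step_ge0 x t.
have c0 : 0 <= c by rewrite (le_trans _ stop_weight_ge1).
have hc := mulr_ge0 c0 (step_ge0 (x - v * T) (t - T)).
by rewrite /profile addr_ge0// -addrA addr_ge0// subr_ge0.
Qed.

Lemma profile0_le x t : 0 <= T -> (t <= T -> v * t <= x) -> (T < t -> v * T <= x) ->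
  profile 0 x t <= 2 + c.
Proof.
move=> T0 h1 h2; have s1 := step_le1 x t.
have c1 : 1 <= c := stop_weight_ge1.
have [tT|Tt] := leP t T.
  rewrite profile_before//; suff : wave v 0 x t <= 1 by lra.
  have [t0|t0] := ltP 0 t; last by rewrite wave_le0.
  rewrite wave0E; apply: (@le_trans _ _ (1 * 1)); last by rewrite mulr1.
  rewrite ler_pM ?expR_ge0 ?step_ge0 ?step_le1// expR_le1.
  by have := h1 tT; rewrite -(ler_pM2l v0) expr2; lra.
have := @wave_sub_le1 (x - v * T) (t - T) T0; rewrite !subrK subr_gt0.
  move=> /(_ Tt) hw.
have hc : c * step 0 (x - v * T) (t - T) <= c.
  by rewrite ger_pMr ?step_le1// (lt_le_trans ltr01 c1).
by rewrite /profile; apply: lerD => //; rewrite -addrA; apply: lerD.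
Qed.

(** After the stop the relaunched wave contributes [heat 0] at the shifted point with the wrong
    sign; the step term absorbs it since [stop_weight] is at least 1. *)
Lemma profile1_le0 x t : 0 <= T -> (T < t -> v * T <= x) -> profile 1 x t <= 0.
Proof.
move=> T0 h; have h0 := heat_ge0 x t.
have [tT|Tt] := leP t T.
  rewrite profile_before// stepS waveS.
  by have := mulr_ge0 (ltW v0) (wave_ge0 v x t); lra.
have := @wave_le_along (x - v * T) (t - T) T0; rewrite !subrK subr_ge0 subr_gt0.
move=> /(_ Tt (h Tt)); rewrite -(ler_pM2l v0) => hw.
have c1 : 0 <= c - 1 by rewrite subr_ge0 stop_weight_ge1.
have := mulr_ge0 c1 (heat_ge0 (x - v * T) (t - T)).
by rewrite /profile !stepS !waveS; lra.
Qed.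

(** After the stop, with X = x - v T and tau = t - T: if X^2 >= 2 tau, [wave2_along_ge] leaves only
    [heat 1] terms of the right sign. Otherwise the Gaussian factor is at least 1/2 and X >= 1 / v,
    so the step term is at least c w / (4 v tau^(3/2)), which beats the error of [wave2_along] by
    the choice of c. *)
Lemma profile2_ge0 x t : 0 <= T -> (t <= T -> 0 <= x) -> (T < t -> v * T + v^-1 <= x) ->
  0 <= profile 2 x t.
Proof.
move=> T0 h1 h2; have [t0|t0] := leP t 0; first by rewrite profile_le0.
have vi : 0 < v^-1 by rewrite invr_gt0.
have [tT|Tt] := leP t T.
  rewrite profile_before// stepS wave2E.
  have := heat1_le0 (h1 tT) t0; have := mulr_ge0 (ltW v0) (heat_ge0 x t).
  by have := mulr_ge0 (sqr_ge0 v) (wave_ge0 v x t); lra.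
have {h1 h2} hx := h2 Tt.
pose X := x - v * T; pose tau := t - T.
have vX : v^-1 <= X by rewrite /X; lra.
have tau0 : 0 < tau by rewrite subr_gt0.
have X0 : 0 <= X by apply: le_trans vX; exact: ltW.
have x0 : 0 <= x by have := mulr_ge0 (ltW v0) T0; lra.
have k1 := heat1_le0 x0 t0; have k2 := heat1_le0 X0 tau0.
have c1 : 1 <= c := stop_weight_ge1.
rewrite /profile -/X -/tau !stepS.
have [hX|hX] := leP (2 * tau) (X ^+ 2).
  have := @wave2_along_ge X tau T0 tau0 X0 hX vX; rewrite !subrK => kw.
  have : 0 <= (c - 1) * - heat 1 X tau by rewrite mulr_ge0; lra.
  lra.
have := @wave2_along X tau T0 tau0 X0; rewrite !subrK ler_norml => /andP[kw _].
suff : K3 / (v * tau * Num.sqrt tau) <= c * - heat 1 X tau by lra.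
have r0 : 0 < Num.sqrt tau by rewrite sqrtr_gt0.
have e2 : 1 / 2 <= expR (- (X ^+ 2 / (4 * tau))).
  apply: (@le_trans _ _ (expR (- (1/2)))).
    by apply: le_trans (expR_ge1Dx _); lra.
  by rewrite ler_expR lerN2 ler_pdivrMr ?mulr_gt0//; lra.
rewrite heat1E opprK heat0E//.
have -> : K3 / (v * tau * Num.sqrt tau) =
    (4 * K3 / w) * ((v^-1 / (2 * tau)) * (w / Num.sqrt tau * (1 / 2))).
  by field; rewrite !gt_eqF// bell_weight_gt0.
have K0 : 0 <= K3 by exact: heat3_bound_ge0.
have wr : 0 <= w / Num.sqrt tau by rewrite divr_ge0 ?(ltW r0).
have ti : 0 < (2 * tau)^-1 by rewrite invr_gt0 mulr_gt0.
apply: ler_pM.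
- by rewrite divr_ge0// mulr_ge0.
- apply: mulr_ge0; first by rewrite mulr_ge0 ?(ltW vi) ?(ltW ti).
  by rewrite mulr_ge0//; lra.
- by rewrite stop_weightE lerDl.
apply: ler_pM.
- by rewrite mulr_ge0 ?(ltW vi) ?(ltW ti).
- by rewrite mulr_ge0//; lra.
- by rewrite ler_pM2r.
- by rewrite ler_wpM2l.
Qed.

Definition rate_bound : R := heat3_bound + bell_weight + stop_weight * bell_weight.

Lemma rate_bound_ge0 : 0 <= rate_bound.
Proof.
have c0 : 0 <= c := le_trans ler01 stop_weight_ge1.
apply: addr_ge0; last exact: mulr_ge0.
by apply: addr_ge0 => //; exact: heat3_bound_ge0.
Qed.

(** By the heat equation this bounds the growth in time. Once v sqrt (t - T) >= 1 the error of
    [wave2_along] is at most [heat3_bound] / (t - T), and no constant depends on [v]. *)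
Lemma profile2_le x t : 0 <= T -> T < t -> v * T <= x -> v^-1 ^+ 2 <= t - T ->
  profile 2 x t <= rate_bound / (t - T).
Proof.
move=> T0 Tt hx hv; pose X := x - v * T; pose tau := t - T.
have tau0 : 0 < tau by rewrite subr_gt0.
have t0 : 0 < t by lra.
have X0 : 0 <= X by rewrite subr_ge0.
have := @wave2_along X tau T0 tau0 X0; rewrite !subrK ler_norml => /andP[_ kw].
have c1 : 1 <= c := stop_weight_ge1.
have k1 := heat1_ge x t0.
have k2 : c * - heat 1 X tau <= c * (w / tau) by rewrite ler_wpM2l ?heat1_ge//; lra.
have k3 : w / t <= w / tau.
  by rewrite ler_wpM2l// lef_pV2 ?posrE//; rewrite /tau; lra.
have k4 : K3 / (v * tau * Num.sqrt tau) <= K3 / tau.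
  have vr : 1 <= v * Num.sqrt tau.
    rewrite mulrC -ler_pdivrMr// mul1r -[leLHS]gtr0_norm ?invr_gt0// -sqrtr_sqr.
    by rewrite ler_wsqrtr.
  have r0 : 0 < Num.sqrt tau by rewrite sqrtr_gt0.
  have tr : 0 < v * tau * Num.sqrt tau by rewrite !mulr_gt0.
  rewrite ler_wpM2l ?heat3_bound_ge0// lef_pV2 ?posrE//.
  by rewrite mulrAC ler_peMl// ltW.
rewrite /profile -/X -/tau !stepS.
have -> : rate_bound / tau = K3 / tau + w / tau + c * (w / tau) by rewrite /rate_bound; ring.
lra.
Qed.

(** At distance 1 / v ahead of v t the exponential equals exp (-1), and the step factor is at least
    1/2 since v t + 1 / v <= 2 v t. *)
Lemma profile0_wave t : 0 < t -> t <= T -> v^-1 <= v * t ->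
  expR (-1) / 2 <= profile 0 (v * t + v^-1) t.
Proof.
move=> t0 tT vt; rewrite profile_before//.
apply: le_trans (_ : wave v 0 (v * t + v^-1) t <= _); last by rewrite lerDr step_ge0.
rewrite wave0E; have -> : v ^+ 2 * t - v * (v * t + v^-1) = -1.
  by field; rewrite gt_eqF.
by rewrite ler_pM2l ?expR_gt0// step_ge_half//; lra.
Qed.

(** With v T fixed the first term tends to 0 as [v] grows; the second is the boundary layer, of
    width 1 / v. *)
Lemma profile0_end x : 0 < T -> v * T <= x ->
  profile 0 x T <= expR (- (v ^+ 2 * T / 4)) + expR (- (v * (x - v * T))).
Proof.
move=> T0 hx; rewrite profile_before//; apply: lerD.
  have vT : 0 <= v * T by rewrite mulr_ge0// ltW.
  apply: le_trans (step_le_exp _ T0) _; first lra.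
  rewrite ler_expR lerN2 ler_pdivlMr ?mulr_gt0//.
  have -> : v ^+ 2 * T / 4 * (4 * T) = (v * T) ^+ 2 by field.
  by apply: lerXn2r; rewrite ?nnegrE; lra.
rewrite wave0E -[leRHS]mulr1 ler_pM ?expR_ge0 ?step_ge0 ?step_le1// ler_expR; lra.
Qed.

End Profile.

Opaque profile rate_bound.

(** * The front of a caloric function *)

Section Front.
Context {R : realType}.
Implicit Types (U : nat -> R -> R -> R) (x y t : R).

(** These are the bounds of 1 - exp (t - x) minus a perturbation with values in [0, 1/2], decreasing
    and convex in x. The lower bound on the value forces positivity for large x, hence a zero. *)
Definition regular_at U x t : Prop :=
  [/\ caloric_at U x t, expR (t - x) <= U 1%N x t, U 2%N x t <= 0 &
      2^-1 - expR (t - x) <= U 0%N x t <= 1 - expR (t - x)].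

(** The point [y] lies behind the front at [t0] and, by continuity, at nearby times, so a single
    half-line serves them all. *)
Definition good U t0 : Prop := exists y, U 0%N y t0 < 0 /\
  \forall t \near t0, forall x, y <= x -> regular_at U x t.

Definition front U t : R :=
  xget 0 [set x | U 0%N x t = 0 /\ forall x', x < x' -> 0 < U 0%N x' t].

Lemma regular_lt U t y : (forall x, y <= x -> regular_at U x t) ->
  forall a b, y <= a -> a < b -> U 0%N a t < U 0%N b t.
Proof.
move=> h a b ya ab; apply: (@lt_of_derive_gt0 R (U 0%N ^~ t) (U 1%N ^~ t)) => // x /andP[ax _].
  by have [/(_ 0%N)[]] := h x (le_trans ya ax).
have [_ + _ _] := h x (le_trans ya ax); exact/lt_le_trans/expR_gt0.
Qed.

Lemma frontP U t y : U 0%N y t < 0 -> (forall x, y <= x -> regular_at U x t) ->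
  [/\ U 0%N (front U t) t = 0, y < front U t &
      forall x, front U t < x -> 0 < U 0%N x t].
Proof.
(* Here Y - t >= 2, so exp (t - Y) < 1/2 and the value at Y is positive. *)
move=> yneg h; pose Y := Num.max y (t + 1) + 1.
have yY : y <= Y by rewrite /Y ler_wpDr// le_max lexx.
have YU : 0 < U 0%N Y t.
  have [_ _ _ /andP[+ _]] := h Y yY; apply: lt_le_trans.
  rewrite subr_gt0 -[_ - _]opprB expRN ltf_pV2 ?posrE ?expR_gt0//.
  apply: lt_le_trans (expR_ge1Dx (Y - t)).
  have : t + 1 <= Num.max y (t + 1) by rewrite le_max lexx orbT.
  by rewrite /Y; lra.
have [c] : exists2 c, c \in `[y, Y] & U 0%N c t = 0.
  apply: (@IVT R (U 0%N ^~ t)) => //.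
    apply: derivable_within_continuous => x; rewrite in_itv /= => /andP[yx _].
    by have [/(_ 0%N)[[]]] := h x yx.
  by rewrite ge_min le_max (ltW yneg) (ltW YU) orbT.
rewrite in_itv /= => /andP[yc _] c0.
have inc := regular_lt h.
have cP : U 0%N c t = 0 /\ forall x', c < x' -> 0 < U 0%N x' t.
  by split=> // x cx; rewrite -c0; exact: inc.
have [f0 fpos] : [set x | U 0%N x t = 0 /\ forall x', x < x' -> 0 < U 0%N x' t] (front U t).
  exact: (xgetI 0 cP).
split=> //; have [//|fy] := ltP y (front U t).
have [E|] := eqVneq (front U t) y; first by move: yneg; rewrite -E f0 ltxx.
by move=> ne; have := fpos y; rewrite lt_neqAle ne fy => /(_ isT); rewrite ltNge (ltW yneg).
Qed.

Definition front_speed U t : R := - (U 2%N (front U t) t / U 1%N (front U t) t).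

Section Good.
Variables (U : nat -> R -> R -> R) (t0 : R).
Hypothesis gU : good U t0.

Lemma good_near : exists y, \forall t \near t0,
  [/\ forall x, y <= x -> regular_at U x t, U 0%N (front U t) t = 0,
      y < front U t & forall x, front U t < x -> 0 < U 0%N x t].
Proof.
have [y [yneg h]] := gU; exists y.
have [/(_ 0%N)[_ d _] _ _ _] := nbhs_singleton h y (lexx y).
have := is_derive_continuous d => /cvgr_lt /(_ _ yneg).
by apply: filterS2 h => t h1 h2; have [? ? ?] := frontP h2 h1.
Qed.

Lemma front0 : U 0%N (front U t0) t0 = 0.
Proof. by have [y /nbhs_singleton[]] := good_near. Qed.

Lemma front_regular x t : front U t0 <= x -> t = t0 -> regular_at U x t.
Proof.
move=> fx ->; have [y /nbhs_singleton[h _ yf _]] := good_near.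
by apply: h; exact: le_trans (ltW yf) fx.
Qed.

Lemma front_regular_near x : front U t0 <= x ->
  \forall p \near (x, t0), regular_at U p.1 p.2.
Proof.
move=> fx; have [y hy] := good_near.
have [_ _ yf _] := nbhs_singleton hy.
have h1 := near_fst t0 (lt_nbhsr (lt_le_trans yf fx)).
have h2 := near_snd x hy.
by apply: filterS2 h1 h2 => p p1 [h _ _ _]; apply: h; exact: ltW.
Qed.

Lemma front_caloric_near x : front U t0 <= x ->
  \forall p \near (x, t0), caloric_at U p.1 p.2.
Proof. by move=> /front_regular_near; apply: filterS => p []. Qed.

Lemma front_continuous : {for t0, continuous (front U)}.
Proof.
have [y hy] := good_near; have [h G0 yG Gpos] := nbhs_singleton hy.
have ct x : y <= x -> {for t0, continuous (U 0%N x)}.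
  by move=> yx; have [/(_ 0%N)[_ d _] _ _ _] := h x yx; exact: is_derive_continuous d.
apply/cvgrPdist_le => e e0.
have up : \forall t \near t0, 0 < U 0%N (front U t0 + e) t.
  have yG' : y <= front U t0 + e by rewrite ler_wpDr ?ltW.
  by have /cvgr_gt := ct _ yG'; apply; apply: Gpos; rewrite ltrDl.
(* The maximum keeps the left test point inside the half-line where [U] increases. *)
pose l := Num.max y (front U t0 - e).
have lo : \forall t \near t0, U 0%N l t < 0.
  have yl : y <= l by rewrite le_max lexx.
  have /cvgr_lt := ct _ yl; apply; rewrite -[ltRHS]G0; apply: (regular_lt h); first by rewrite le_max lexx.
  by rewrite gt_max yG gtrBl.
near=> t.
have [ht Gt yGt _] : [/\ forall x, y <= x -> regular_at U x t, U 0%N (front U t) t = 0,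
      y < front U t & forall x, front U t < x -> 0 < U 0%N x t] by near: t.
have u1 : 0 < U 0%N (front U t0 + e) t by near: t.
have u2 : U 0%N l t < 0 by near: t.
rewrite ler_distlC; apply/andP; split.
  rewrite leNgt; apply/negP => c; have yl : y <= l by rewrite le_max lexx.
  have : front U t <= l by rewrite le_max (ltW c) orbT.
  rewrite le_eqVlt => /predU1P[E|fl]; first by move: u2; rewrite -E Gt ltxx.
  by have := regular_lt ht (ltW yGt) fl; rewrite Gt ltNge (ltW u2).
rewrite leNgt; apply/negP => c.
have yl : y <= front U t0 + e by rewrite (le_trans (ltW yG))// lerDl ltW.
by have := regular_lt ht yl c; rewrite Gt ltNge (ltW u1).
Unshelve. all: by end_near. Qed.

Lemma is_derive_front : is_derive t0 1 (front U) (front_speed U t0).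
Proof.
have [c1 k0 _ _] := front_regular (lexx _) erefl.
pose k := U 1%N (front U t0) t0; pose a := U 2%N (front U t0) t0.
have {k0} k0 : 0 < k by exact: lt_le_trans (expR_gt0 _) k0.
apply/is_deriveP => e e0.
pose M := 2 * (`|a| + 1) / k.
have M0 : 0 < M by rewrite divr_gt0// mulr_gt0// ltr_wpDl.
(* Implicit differentiation by hand: [k / 2] lets the error in D be absorbed, which gives |D| <= M
   |s|; with that bound each error term costs at most half of k e |s|. *)
pose e1 := Num.min (k / 2) (k * e / (2 * M)); pose e2 := Num.min 1 (k * e / 2).
have e10 : 0 < e1.
  by rewrite lt_min; apply/andP; split; apply: divr_gt0 => //; apply: mulr_gt0.
have e20 : 0 < e2.
  by rewrite lt_min ltr01; apply: divr_gt0 => //; apply: mulr_gt0.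
have cn := front_caloric_near (lexx _).
have [_ /is_deriveP dt _] := c1 0%N.
have [_ _ cw1] := c1 1%N.
have dn : \forall p \near (front U t0, t0), is_derive (p.1 : R) 1 (U 0%N ^~ p.2) (U 1%N p.1 p.2).
  by apply: filterS cn => p /(_ 0%N)[].
have /near_pairP[d d0 sl] := partial_slope dn cw1 e10.
have [y hy] := good_near.
near=> t.
have [_ Gt _ _] : [/\ forall x, y <= x -> regular_at U x t, U 0%N (front U t) t = 0,
      y < front U t & forall x, front U t < x -> 0 < U 0%N x t] by near: t.
have h1 : `|U 0%N (front U t) t - U 0%N (front U t0) t - k * (front U t - front U t0)| <=
    e1 * `|front U t - front U t0|.
  apply: sl; last by near: t; exact: near_dist_lt.
  near: t; have /cvgrPdist_lt := front_continuous; move=> /(_ _ d0).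
  by apply: filterS => z; rewrite distrC.
have h2 : `|U 0%N (front U t0) t - U 0%N (front U t0) t0 - a * (t - t0)| <= e2 * `|t - t0|.
  by near: t; exact: dt.
rewrite Gt sub0r in h1; rewrite front0 subr0 in h2.
rewrite /front_speed -/k -/a.
set D := front U t - front U t0 in h1 *; set s := t - t0 in h2 *.
set b := U 0%N (front U t0) t in h1 h2.
have h3 : `|k * D + a * s| <= e1 * `|D| + e2 * `|s|.
  have -> : k * D + a * s = - (- b - k * D) - (b - a * s) by ring.
  by apply: le_trans (ler_normB _ _) _; rewrite normrN lerD.
have h4 : `|D| <= M * `|s|.
  have : k * `|D| <= e1 * `|D| + (e2 + `|a|) * `|s|.
    rewrite -[X in X * `|D|]gtr0_norm// -normrM.
    rewrite -[k * D](addrK (a * s)); apply: le_trans (ler_normB _ _) _.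
    by rewrite normrM mulrDl addrA lerD2r.
  have : e1 * `|D| <= k * `|D| / 2 by rewrite mulrAC ler_wpM2r// ge_min lexx.
  have : (e2 + `|a|) * `|s| <= (`|a| + 1) * `|s|.
    by rewrite ler_wpM2r// addrC lerD2l ge_min lexx.
  move=> m1 m2 m3; rewrite /M mulrAC ler_pdivlMr// mulrC.
  move: m1 m2 m3; move: (e1 * `|D|) ((e2 + `|a|) * `|s|) => p q; rewrite -[in X in _ -> _ -> _ -> _ <= X]mulrA.
  move: (k * `|D|) ((`|a| + 1) * `|s|) => u z.
  lra.
have -> : D - - (a / k) * s = (k * D + a * s) / k by field; rewrite gt_eqF.
rewrite normrM normfV (gtr0_norm k0) ler_pdivrMr//; apply: le_trans h3 _.
have : e1 * `|D| <= k * e / 2 * `|s|.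
  apply: (@le_trans _ _ (k * e / (2 * M) * (M * `|s|))).
    by rewrite ler_pM// ?(ltW e10)// ge_min lexx orbT.
  by rewrite le_eqVlt; apply/orP; left; apply/eqP; field; rewrite gt_eqF.
have : e2 * `|s| <= k * e / 2 * `|s| by rewrite ler_wpM2r// ge_min lexx orbT.
lra.
Unshelve. all: by end_near. Qed.

Lemma front_speed_ge0 : 0 <= front_speed U t0.
Proof.
have [_ h1 h2 _] := front_regular (lexx _) erefl.
rewrite /front_speed -mulNr divr_ge0 ?oppr_ge0// (le_trans _ h1)// expR_ge0.
Qed.

Lemma is_derive_trace j r : 0 <= r ->
  is_derive t0 1 (fun t => U j (r + front U t) t)
    (U j.+1 (r + front U t0) t0 * front_speed U t0 + U j.+2 (r + front U t0) t0).
Proof.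
move=> r0; apply: (@caloric_along _ U (fun t => r + front U t)).
  by apply: front_caloric_near; rewrite lerDr.
by have := is_deriveD (is_derive_cst r t0 1) is_derive_front; rewrite add0r.
Qed.

Lemma continuous_trace j r : 0 <= r ->
  {for (r, t0), continuous (fun p : R * R => U j (p.1 + front U p.2) p.2)}.
Proof.
move=> r0; have fr : front U t0 <= r + front U t0 by rewrite lerDr.
have [c _ _ _] := front_regular fr erefl; have [_ _ cj] := c j.
apply/cvgrPdist_le => e e0; move/cvgrPdist_le : cj => /(_ e e0) /near_pairP[d d0 hd].
have /cvgrPdist_lt /(_ (d / 2)) := front_continuous; rewrite divr_gt0// => /(_ isT).
move=> /near_distP[d1 d10 hf]; apply/near_pairP.
exists (Num.min (d / 2) (Num.min d d1)); first by rewrite !lt_min d0 d10 divr_gt0.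
move=> x s; rewrite !lt_min => /and3P[xr _ _] /and3P[_ sd sd1].
apply: hd => //=.
have -> : x + front U s - (r + front U t0) = (x - r) + (front U s - front U t0) by ring.
apply: le_lt_trans (ler_normD _ _) _.
by have := hf s sd1; rewrite distrC; lra.
Qed.

End Good.
End Front.

(** * Smoothness of the front speed *)

Section Smoothness.
Context {R : realType}.
Implicit Types (f : R -> R) (D : set R).

Lemma smooth_on_tower D (F : nat -> R -> R) :
  (forall n x, D x -> is_derive x 1 (F n) (F n.+1 x)) -> smooth_on D (F 0%N).
Proof.
move=> dF; exists F; split=> // n x Dx.
apply/cvgrPdist_le => e e0; rewrite near_withinE.
have /is_deriveP /(_ e e0) := dF n x Dx.
move=> /near_distP[d d0 h]; apply/nbhs_ballP; exists d => //= y; rewrite /ball /= distrC => yd.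
move=> yx _; have {}yx : y - x != 0 by rewrite subr_eq0.
have := h y yd; rewrite -ler_pdivrMr ?normr_gt0// -normfV -normrM distrC.
by congr (`|_| <= _); field.
Qed.

(* The algebra generated by the traces t |-> U j (front t) t and by the inverse
   of the one with j = 1 contains the speed of the front and is stable
   under d/dt. *)
Inductive expr :=
  | Trace of nat | Inv1 | Opp of expr | Add of expr & expr | Mul of expr & expr.

Definition speed_expr := Opp (Mul (Trace 2) Inv1).
Definition trace_diff j := Add (Mul (Trace j.+1) speed_expr) (Trace j.+2).

Fixpoint diff e := match e with
  | Trace j => trace_diff j
  | Inv1 => Opp (Mul (Mul Inv1 Inv1) (trace_diff 1))
  | Opp a => Opp (diff a)
  | Add a b => Add (diff a) (diff b)
  | Mul a b => Add (Mul a (diff b)) (Mul b (diff a))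
  end.

Variable U : nat -> R -> R -> R.

Fixpoint eval e t : R := match e with
  | Trace j => U j (front U t) t
  | Inv1 => (U 1%N (front U t) t)^-1
  | Opp a => - eval a t
  | Add a b => eval a t + eval b t
  | Mul a b => eval a t * eval b t
  end.

Lemma is_derive_eval e t : good U t -> is_derive t 1 (eval e) (eval (diff e) t).
Proof.
move=> g; have dT j : is_derive t 1 (eval (Trace j)) (eval (trace_diff j) t).
  have := is_derive_trace g j (lexx 0); rewrite add0r /front_speed /= => h.
  by under eq_fun do rewrite -[X in U j X]add0r.
elim: e => [j||a iha|a iha b ihb|a iha b ihb].
- exact: dT.
- have [_ u1 _ _] := front_regular g (lexx _) erefl.
  have u0 : eval (Trace 1) t != 0 by rewrite gt_eqF// (lt_le_trans _ u1)// expR_gt0.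
  have ? := dT 1%N.
  have -> : eval Inv1 = (fun s => (eval (Trace 1) s)^-1) by [].
  apply: is_derive_eq; rewrite /GRing.scale /=.
  by rewrite mulNr expr2 invfM.
- exact: is_deriveN.
- exact: is_deriveD.
- by apply: is_derive_eq.
Qed.

End Smoothness.

(** * Back to the half-line: the drift and the solution in the frame of the front *)

Section PairOfGood.
Context {R : realType}.
Variable U : nat -> R -> R -> R.
(** Negative times are included, so that derivatives at t = 0 can be taken two-sided. *)
Hypothesis gU : forall t : R, t < 1 -> good U t.
Hypothesis U0E : forall x : R, U 0%N x 0 = 1 - expR (- x).

Let g := front_speed U.
Let q r t := U 0%N (r + front U t) t.

Lemma front_at0 : front U 0 = 0.
Proof.
have := front0 (gU ltr01); rewrite U0E => /eqP; rewrite subr_eq0 eq_sym => /eqP.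
by rewrite -expR0 => /expR_inj /eqP; rewrite oppr_eq0 => /eqP.
Qed.

Lemma drift_front_speed : drift g.
Proof.
split; last by move=> t /andP[_ t1]; apply: front_speed_ge0; exact: gU.
have -> : g = eval U speed_expr by [].
apply: (@smooth_on_tower _ _ (fun n => eval U (iter n diff speed_expr))) => n t /=.
by rewrite in_itv /= => /andP[_ t1]; apply: is_derive_eval; exact: gU.
Qed.

Let q_dr (r t : R) j : t < 1 -> 0 <= r ->
  is_derive r 1 (fun r => U j (r + front U t) t) (U j.+1 (r + front U t) t).
Proof.
move=> t1 r0; have [/(_ j)[d _ _] _ _ _] : regular_at U (r + front U t) t.
  by apply: (front_regular (gU t1)) => //; rewrite lerDr.
have : is_derive r 1 ((U j ^~ t) \o shift (front U t)) (U j.+1 (r + front U t) t * 1).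
  by apply: is_derive1_comp => //; exact: is_derive_shift.
by rewrite mulr1.
Qed.

Let dtE (r t : R) : 0 < r -> t < 1 ->
  dt q (r, t) = U 1%N (r + front U t) t * g t + U 2%N (r + front U t) t.
Proof.
move=> r0 t1; rewrite /dt derive1E /=.
by have [_ ->] := is_derive_trace (gU t1) 0 (ltW r0).
Qed.

Let drE (r t : R) : 0 < r -> t < 1 -> dr q (r, t) = U 1%N (r + front U t) t.
Proof.
by move=> r0 t1; rewrite /dr derive1E /=; have [_ ->] := q_dr 0 t1 (ltW r0).
Qed.

Let is_derive_dr (r t : R) : 0 < r -> t < 1 ->
  is_derive r 1 (derive1 (q^~ t)) (U 2%N (r + front U t) t).
Proof.
move=> r0 t1; apply: near_eq_is_derive (q_dr 1 t1 (ltW r0)).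
near=> s; have s0 : 0 < s by near: s; exact: lt_nbhsr.
by rewrite -[RHS]/(dr q (s, t)) drE.
Unshelve. all: by end_near. Qed.

Let drrE (r t : R) : 0 < r -> t < 1 -> drr q (r, t) = U 2%N (r + front U t) t.
Proof.
by move=> r0 t1; rewrite /drr derive1Sn derive1n1 derive1E /=;
  have [_ ->] := is_derive_dr r0 t1.
Qed.

Let region (r t : R) : 0 < r -> t < 1 -> \forall p \near (r, t), 0 < p.1 /\ p.2 < (1:R).
Proof.
move=> r0 t1; have h1 := near_fst t (lt_nbhsr r0); have h2 := near_snd r (lt_nbhsl t1).
by apply: filterS2 h1 h2.
Qed.

Let continuous_eq (f h : R * R -> R) (r t : R) : 0 < r -> t < 1 ->
  (forall r t : R, 0 < r -> t < 1 -> f (r, t) = h (r, t)) ->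
  {for (r, t), continuous h} -> {for (r, t), continuous f}.
Proof.
move=> r0 t1 e; rewrite /prop_for /continuous_at e// => c; apply: cvg_trans c.
by apply: near_eq_cvg; apply: filterS (region r0 t1) => -[x s] /= [? ?]; rewrite e.
Qed.

Let continuous_speed (t : R) : t < 1 -> {for t, continuous g}.
Proof.
by move=> t1; have := is_derive_eval speed_expr (gU t1); exact: is_derive_continuous.
Qed.

Lemma dirichlet_front : dirichlet_solution g q.
Proof.
split.
- apply: continuous_in_subspaceT => -[r t]; rewrite inE => -[] /=.
  rewrite !in_itv /= andbT => r0 /andP[_ t1].
  exact: (continuous_trace (j := 0%N) (gU t1) r0).
- move=> r t r0 /andP[t0 t1]; split; last first.
    by rewrite dtE// drrE// drE// addrC mulrC.
  have ct j := continuous_trace (j := j) (gU t1) (ltW r0).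
  split; split.
  + by case: (is_derive_trace (gU t1) 0 (ltW r0)).
  + by case: (q_dr 0 t1 (ltW r0)).
  + by case: (is_derive_dr r0 t1).
  + apply: (continuous_eq r0 t1 dtE (h := fun p => U 1%N (p.1 + front U p.2) p.2 * g p.2 + U 2%N (p.1 + front U p.2) p.2)).
    apply: cvgD; last exact: ct.
    apply: cvgM; first exact: ct.
    by apply: (cvg_comp snd g); [exact: cvg_snd|exact: continuous_speed].
  + exact: (continuous_eq r0 t1 drE (h := fun p => U 1%N (p.1 + front U p.2) p.2)).
  + exact: (continuous_eq r0 t1 drrE (h := fun p => U 2%N (p.1 + front U p.2) p.2)).
- by move=> t /andP[_ t1]; rewrite /q add0r; exact: front0 (gU t1).
Qed.

Lemma pair_front : drift_diffusion_pair g q.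
Proof.
have qE r : 0 <= r -> q r 0 = 1 - expR (- r).
  by rewrite /q U0E front_at0 addr0.
have q01 r t : 0 <= r -> t < 1 -> 0 <= q r t <= 1.
  move=> r0 t1; have fr : front U t <= r + front U t by rewrite lerDr.
  have [_ _ _ /andP[_ h]] := front_regular (gU t1) fr erefl.
  rewrite /q (le_trans h) ?andbT; last by rewrite gerBl expR_ge0.
  have [y /nbhs_singleton[_ f0 _ fpos]] := good_near (gU t1).
  by move: fr; rewrite le_eqVlt => /predU1P[<-|/fpos/ltW//]; rewrite f0.
split.
- exact: drift_front_speed.
- exact: dirichlet_front.
- by exists 1 => r t r0 /andP[_ t1]; exact: q01.
split.
- pose F n (r : R) := (n == 0%N)%:R - (-1) ^+ n * expR (- r).
  have [F' [e dF]] : smooth_on `[0, +oo[%classic (F 0%N).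
    apply: smooth_on_tower => n r _; rewrite /F; apply: is_derive_eq.
    by rewrite /GRing.scale /= exprS; ring.
  exists F'; split=> // r r0; rewrite e// /F expr0 mul1r /= qE//.
  by move: r0; rewrite /= in_itv /= andbT.
- by exists 1 => r r0; have /andP[? ?] := q01 r 0 r0 ltr01; rewrite ger0_norm.
- move=> r s r0 rs; rewrite !qE ?(le_trans r0 rs)//.
  by rewrite lerD2l lerN2 ler_expR lerN2.
Qed.

End PairOfGood.

(** * Adding a wave *)

Section Solution.
Context {R : realType}.
Implicit Types (p : nat -> R -> R -> R) (x y t : R).

Definition base (j : nat) x t : R := (j == 0%N)%:R - (-1) ^+ j * expR (t - x).

Lemma caloric_base x t : caloric_at base x t.
Proof.
move=> j; split.
- rewrite /base; apply: is_derive_eq; rewrite /GRing.scale /= exprS; ring.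
- rewrite /base; apply: is_derive_eq; rewrite /GRing.scale /= !exprS; ring.
- apply: cvgB; first exact: cvg_cst.
  apply: cvgM; first exact: cvg_cst.
  have h : p.2 - p.1 @[p --> (x, t)] --> t - x by apply: cvgB; [exact: cvg_snd|exact: cvg_fst].
  by apply: (cvg_comp _ _ h); exact: continuous_expR.
Qed.

Definition sol p (j : nat) x t : R := base j x t - p j x t.

Definition pert_ok p x t : Prop :=
  [/\ caloric_at p x t, p 1%N x t <= 0, 0 <= p 2%N x t & 0 <= p 0%N x t <= 2^-1].

Lemma sol0E p x t : sol p 0%N x t = 1 - expR (t - x) - p 0%N x t.
Proof. by rewrite /sol /base expr0 mul1r. Qed.

Lemma pert_regular p x t : pert_ok p x t -> regular_at (sol p) x t.
Proof.
move=> [c p1 p2 /andP[p0 p0']]; split.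
- have := caloric_atD (caloric_base x t) (caloric_atZ (-1) c).
  congr caloric_at; apply/funext => j; apply/funext => y; apply/funext => s.
  by rewrite /sol mulN1r.
- by rewrite /sol /base expr1 sub0r mulN1r opprK lerBrDr gerDl.
- by rewrite /sol /base sub0r expr2 mulrNN !mul1r; have := expR_gt0 (t - x); lra.
- by rewrite sol0E; apply/andP; split; lra.
Qed.

(** The time derivative is [U 2], which is nonpositive at regular points. *)
Lemma regular_le U x a b : a <= b ->
  (forall t, a <= t <= b -> regular_at U x t) -> U 0%N x b <= U 0%N x a.
Proof.
move=> ab h; apply: (@ge_of_derive_le0 R (U 0%N x) (U 2%N x)) => // t tab.
  by have [/(_ 0%N)[]] := h t tab.
by have [] := h t tab.
Qed.

(* [d] is the time left, and [k * (1 - 2 * d)] is the part of the budget for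
   the displacement of the front that is spent by the previous waves. *)
Definition stage (k d : R) p : Prop := exists y c,
  [/\ c < 1 - d, sol p 0%N y (1 - d) < 0,
   forall x t, y <= x -> c < t -> pert_ok p x t /\ p 0%N x t <= 2^-1 - d &
   forall x t t', y <= x -> t <= t' -> t' <= 1 ->
     p 0%N x t' - p 0%N x t <= k * (1 - 2 * d) * Num.sqrt (1 - t)].

Definition add_wave p (b v T x0 t0 : R) (j : nat) x t : R :=
  p j x t + b * profile v T j (x - x0) (t - t0).

Section AddWave.
Variables (p : nat -> R -> R -> R) (b v T x0 t0 : R).
Hypotheses (b0 : 0 <= b) (v0 : 0 < v) (T0 : 0 <= T).

(* The points that the wave leaves in front of it, with a margin [v^-1] once it
   has stopped; there [profile] has the right signs. *)
Definition ahead x t : Prop :=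
  [/\ x0 < x, t - t0 <= T -> v * (t - t0) < x - x0 &
      T < t - t0 -> v * T + v^-1 <= x - x0].

Lemma add_wave_ok x t : ahead x t -> pert_ok p x t ->
  p 0%N x t + b * (2 + stop_weight) <= 2^-1 -> pert_ok (add_wave p b v T x0 t0) x t.
Proof.
move=> [x0x h1 h2] [c p1 p2 /andP[p0 _]] hb.
have vi : 0 < v^-1 by rewrite invr_gt0.
have h3 : T < t - t0 -> v * T <= x - x0 by move=> /h2; lra.
have cp : caloric_at (profile v T) (x - x0) (t - t0).
  apply: caloric_profile => //; first by right; rewrite subr_gt0.
  (* At the very instant of the stop the profile is caloric only strictly beyond the stopping point,
     which the condition on the running wave provides. *)
  by have [E|] := eqVneq (t - t0) T; [right; rewrite -{1}E; apply: h1; rewrite E|left].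
split.
- by have := caloric_atD c (caloric_atZ b (caloric_at_shift cp)).
- by rewrite /add_wave -[leRHS]addr0 lerD// mulr_ge0_le0// profile1_le0.
- rewrite /add_wave addr_ge0// mulr_ge0// profile2_ge0// => _; rewrite subr_ge0; exact: ltW.
- rewrite /add_wave addr_ge0 ?mulr_ge0 ?profile0_ge0//=.
  apply: le_trans hb; rewrite lerD2l ler_wpM2l// profile0_le// => /h1; exact: ltW.
Qed.

Lemma add_wave_le (j : nat) x t : t <= t0 -> add_wave p b v T x0 t0 j x t = p j x t.
Proof. by move=> tt; rewrite /add_wave profile_le0 ?mulr0 ?addr0//; lra. Qed.

End AddWave.

(* Short times before 1 are controlled by the decay rate of d/dt, the others by
   the height of the profile. *)
Lemma profile_incr (b v T k d x t t' : R) :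
  0 <= b -> 0 < v -> 0 <= T -> 0 < d -> 0 <= k ->
  T <= d / 4 -> v^-1 ^+ 2 <= d / 4 -> v * T <= x -> t <= t' -> t' <= 1 ->
  b * (2 + stop_weight) <= k * Num.sqrt (d / 2) ->
  b * (4 * rate_bound) <= k * Num.sqrt d ->
  b * (profile v T 0%N x (t' - (1 - d)) - profile v T 0%N x (t - (1 - d))) <=
  k * Num.sqrt (1 - t).
Proof.
move=> b0 v0 T0 d0 k0 Td vd hx tt' t'1 hb1 hb2; set t0 := 1 - d.
have P0 (u : R) : 0 <= profile v T 0%N x u by exact: profile0_ge0.
have [t2|t2] := leP t (t0 + d / 2).
  apply: le_trans (_ : k * Num.sqrt (d / 2) <= _); last first.
    by rewrite ler_wpM2l// ler_wsqrtr// lerBrDr addrC -lerBrDr (le_trans t2)// /t0; clear; lra.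
  apply: le_trans hb1; rewrite ler_wpM2l//.
  have : profile v T 0%N x (t' - t0) <= 2 + stop_weight.
    apply: profile0_le => // h; apply: le_trans hx; by rewrite ler_pM2l.
  by move=> h; apply: le_trans h; rewrite gerBl.
have h : profile v T 0%N x (t' - t0) - profile v T 0%N x (t - t0) <=
    4 * rate_bound / d * (t' - t).
  have := @sub_le_of_derive_le R (profile v T 0%N x) (fun s => 4 * rate_bound / d * s)
    (profile v T 2%N x) (fun=> 4 * rate_bound / d) (t - t0) (t' - t0) _ _ _ _.
  rewrite -mulrBr; have -> : t' - t0 - (t - t0) = t' - t by ring.
  apply; first by rewrite lerD2r.
  - move=> s /andP[s1 s2].
    have cp : caloric_at (profile v T) x s.
      apply: caloric_profile => //; left; rewrite gt_eqF//; clear -s1 t2 d0 Td T0; lra.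
    by have [] := cp 0%N.
  - by move=> s _; apply: (@is_derive_affine _ _ _ 0) => y; rewrite add0r.
  (* At least d / 2 - d / 4 has elapsed since the stop, whence the factor 4 on [rate_bound]. *)
  - move=> s /andP[s1 s2]; have sT : d / 4 <= s - T by clear -s1 Td t2; lra.
    have sT0 : 0 < s - T by clear -sT d0; lra.
    have Ts : T < s by clear -sT0; lra.
    apply: le_trans (profile2_le v0 T0 Ts hx (le_trans vd sT)) _.
    have -> : 4 * rate_bound / d = rate_bound / (d / 4) by field; rewrite gt_eqF.
    by rewrite ler_wpM2l ?rate_bound_ge0// lef_pV2// posrE; clear -d0 sT sT0; lra.
(* What remains is sqrt d (t' - t) / d <= sqrt (1 - t), which follows from t' - t <= 1 - t <= d. *)
apply: le_trans (ler_wpM2l b0 h) _.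
have -> : b * (4 * rate_bound / d * (t' - t)) = b * (4 * rate_bound) * ((t' - t) / d).
  by field; rewrite gt_eqF.
have q0 : 0 <= (t' - t) / d by rewrite divr_ge0 ?subr_ge0// ltW.
apply: le_trans (ler_wpM2r q0 hb2) _; rewrite -mulrA ler_wpM2l//.
rewrite mulrA ler_pdivrMr//.
have t1 : 0 <= 1 - t by rewrite subr_ge0 (le_trans tt').
have td : 1 - t <= d by clear -t2 d0; rewrite /t0 in t2; lra.
have e1 : Num.sqrt d ^+ 2 = d by rewrite sqr_sqrtr// ltW.
have e2 : Num.sqrt (1 - t) ^+ 2 = 1 - t by rewrite sqr_sqrtr.
have le12 : Num.sqrt (1 - t) <= Num.sqrt d by rewrite ler_wsqrtr.
have A0 := sqrtr_ge0 d; have B0 := sqrtr_ge0 (1 - t).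
apply: (@le_trans _ _ (Num.sqrt d * (1 - t))); first by rewrite ler_wpM2l// lerD2r.
rewrite -[in leLHS]e2 -[X in _ <= _ * X]e1 !expr2 mulrCA ler_wpM2l//.
by rewrite ler_wpM2l.
Qed.

Lemma near0_mull_le (a c : R) : 0 < a -> 0 < c -> \forall z \near (0 : R)^'+, a * z <= c.
Proof.
move=> a0 c0; near=> z; rewrite mulrC -ler_pdivlMr//.
by near: z; apply: nbhs_right_ltW; exact: divr_gt0.
Unshelve. all: by end_near. Qed.

Lemma powR_ge_id (a : R) : 1 <= a -> a <= a `^ (3 / 2).
Proof.
move=> a1; rewrite -[leLHS]powRr1 ?(le_trans ler01 a1)//.
by rewrite ler_powR//; lra.
Qed.

(** The wave starts at 1 - d just behind the front and stops before 1 - d / 2. All requirements on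
    the speed are smallness conditions on its inverse [z], chosen last. The witnesses are r' = a z,
    that is [a] layer widths, and for t' the stopping time. *)
Lemma next_stage (k d : R) (n : nat) p (r : R) :
  0 < k -> 0 < r -> 0 < d -> stage k d p -> exists p' r' t',
  [/\ stage k (d / 2) p',
  forall j x t, t <= 1 - d -> p' j x t = p j x t,
  forall t, 1 - d <= t <= 1 - d / 2 -> good (sol p') t,
  0 < r' /\ r' <= Num.min r d &
  1 - d < t' < 1 - d / 2 /\
  n%:R <= sol p' 0%N (r' + front (sol p') t') t' * `|ln r'| `^ (3 / 2)].
Proof.
move=> k0 r0 d0 pn.
have [y [c0 [c0s yneg ok incr]]] := pn.
have [s sE] : exists s, s = 1 - d by exists (1 - d).
have sS : 1 - d / 2 = s + d / 2 by rewrite sE; lra.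
rewrite sS -sE in c0s yneg *.
have [U UE] : exists U, U = sol p by exists (sol p).
rewrite -UE in yneg.
have reg x t : y <= x -> c0 < t -> regular_at U x t.
  by move=> yx ct; rewrite UE; apply: pert_regular; case: (ok x t yx ct).
have [fG yG fpos] := frontP yneg (fun x yx => reg x s yx c0s).
have [G GE] : exists G, G = front U s by exists (front U s).
rewrite -GE in fG yG fpos.
have inc t : c0 < t -> forall a b, y <= a -> a < b -> U 0%N a t < U 0%N b t.
  by move=> ct; apply: regular_lt => x yx; exact: reg.
have dec x t t' : y <= x -> c0 < t -> t <= t' -> U 0%N x t' <= U 0%N x t.
  move=> yx ct tt; apply: regular_le tt _ => z /andP[tz _].
  by apply: reg yx _; exact: lt_le_trans ct tz.
have w0 : 1 <= @stop_weight R := stop_weight_ge1.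
have rb0 : 0 <= @rate_bound R := rate_bound_ge0.
(* the height of the wave *)
have [b [b0 hb hb1 hb2]] : exists b, [/\ 0 < b, b * (2 + @stop_weight R) <= d / 2,
    b * (2 + @stop_weight R) <= k * d * Num.sqrt (d / 2) &
    b * (4 * @rate_bound R) <= k * d * Num.sqrt d].
  have kd : 0 < k * d by rewrite mulr_gt0.
  have sw : 0 < 2 + @stop_weight R by lra.
  have rw : 0 < 4 * (@rate_bound R + 1) by lra.
  have d2 : 0 < d / 2 by exact: divr_gt0.
  near (0 : R)^'+ => b; exists b.
  have b1 : 0 < b by near: b; exact: nbhs_right_gt.
  split=> //.
  - by rewrite mulrC; near: b; exact: (near0_mull_le sw d2).
  - rewrite mulrC; near: b; apply: (near0_mull_le sw).
    by apply: mulr_gt0 => //; rewrite sqrtr_gt0.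
  - apply: (@le_trans _ _ (b * (4 * (@rate_bound R + 1)))).
      by rewrite !ler_pM2l// lerDl.
    rewrite mulrC; near: b; apply: (near0_mull_le rw).
    by apply: mulr_gt0 => //; rewrite sqrtr_gt0.
have e1 : 0 < expR (-1) :> R by exact: expR_gt0.
have be0 : 0 < b * expR (-1) / 2 by rewrite divr_gt0// mulr_gt0.
(* the distance over which the wave pushes the front *)
have [m [m0 Um]] : exists m, 0 < m /\ U 0%N (G + m) s < b * expR (-1) / 2.
  have [/(_ 0%N)[/is_derive_continuous + _ _] _ _ _] := reg G s (ltW yG) c0s.
  move=> /cvgr_lt /(_ (b * expR (-1) / 2)); rewrite fG => /(_ be0).
  move=> /near_distP[e e0 he]; exists (e / 2); split; first by rewrite divr_gt0.
  by apply: he; rewrite addrAC subrr add0r gtr0_norm; lra.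
have Gm2 : G < G + m / 2 by rewrite ltrDl divr_gt0.
have yGm2 : y <= G + m / 2 by rewrite (le_trans (ltW yG))// ltW.
(* Half the old solution's value halfway along the push: a lower bound that the front will meet,
   fixed before the speed. *)
have [om [om0 [e [e0 he]]]] : exists om, 0 < om /\ exists e, 0 < e /\
    forall t, `|t - s| < e -> om < U 0%N (G + m / 2) t.
  exists (U 0%N (G + m / 2) s / 2); have U1 := fpos _ Gm2.
  split; first by rewrite divr_gt0.
  have [/(_ 0%N)[_ /is_derive_continuous + _] _ _ _] := reg (G + m / 2) s yGm2 c0s.
  move=> /cvgr_gt /(_ (U 0%N (G + m / 2) s / 2)).
  have h : U 0%N (G + m / 2) s / 2 < U 0%N (G + m / 2) s by lra.
  by move=> /(_ h) /near_distP[e' e'0 he]; exists e'.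
(* As exp a >= 1 + a > 4 b / om, the wave has decayed below om / 4 at [a] layer widths. *)
pose a := 4 * b / om + 1.
have a0 : 0 < a by rewrite ltr_wpDl// divr_ge0 ?mulr_ge0// ltW.
have bea : b * expR (- a) <= om / 4.
  have : 4 * b / om < expR a by apply: lt_le_trans (expR_ge1Dx _); rewrite /a; lra.
  rewrite expRN ltr_pdivrMr// ler_pdivrMr ?expR_gt0//; lra.
(* Gives om / 2 * N >= n, while N >= 1 allows the power 3/2 to be bounded below by its base. *)
pose N := 2 * n%:R / om + 1.
have N1 : 1 <= N by rewrite lerDr divr_ge0 ?mulr_ge0 ?ler0n// ltW.
(* the inverse of the speed of the wave, which is the width of its boundary layer *)
near (0 : R)^'+ => z.
have z0 : 0 < z by near: z; exact: nbhs_right_gt.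
have z1 : z <= 1 by near: z; exact: nbhs_right_ltW.
have zm : 3 * z <= m / 2 by near: z; apply: near0_mull_le => //; exact: divr_gt0.
have zy : 3 * z <= G - y by near: z; apply: near0_mull_le => //; rewrite subr_gt0.
have zT : m * z <= e / 2 by near: z; apply: near0_mull_le => //; exact: divr_gt0.
have zTd : m * z <= d / 4 by near: z; apply: near0_mull_le => //; exact: divr_gt0.
have zd : z <= d / 4 by near: z; apply: nbhs_right_ltW; exact: divr_gt0.
have zom : 4 * b / m * z <= om / 4.
  by near: z; apply: near0_mull_le; rewrite divr_gt0// mulr_gt0.
have zr : a * z <= Num.min r d.
  by near: z; apply: near0_mull_le => //; rewrite lt_min r0.
have zN : a * z <= expR (- N) by near: z; apply: near0_mull_le => //; exact: expR_gt0.
have [v vE] : exists v, v = z^-1 by exists z^-1.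
have [T TE] : exists T, T = m * z by exists (m * z).
(* With this offset the test point [yy], one [z] ahead of the wave, is still behind the old front
   while the wave is too young for [profile0_wave]; there [U] is negative already. *)
have [x0 x0E] : exists x0, x0 = G - 3 * z by exists (G - 3 * z).
rewrite -TE in zT zTd.
have v0 : 0 < v by rewrite vE invr_gt0.
have vz : v^-1 = z by rewrite vE invrK.
have T0 : 0 < T by rewrite TE mulr_gt0.
have vT : v * T = m by rewrite vE TE mulrCA mulVf ?mulr1// gt_eqF.
have dT : T < d / 2 by apply: le_lt_trans zTd _; rewrite ltr_pM2l// ltf_pV2 ?posrE// ltr_nat.
have [p' p'E] : exists p', p' = add_wave p b v T x0 s by exists (add_wave p b v T x0 s).
have [U' U'D] : exists U', U' = sol p' by exists (sol p').
have bT x t : y <= x -> c0 < t -> ahead v T x0 s x t -> pert_ok p' x t.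
  move=> yx ct bh; have [ok1 ok2] := ok x t yx ct; rewrite p'E.
  by apply: add_wave_ok; rewrite ?(ltW b0) ?(ltW T0)//; clear -ok2 hb d0; lra.
have U'E x t : U' 0%N x t = U 0%N x t - b * profile v T 0%N (x - x0) (t - s).
  by rewrite UE U'D p'E !sol0E /add_wave opprD addrA.
have after x t : x0 + m + z <= x -> s <= t -> ahead v T x0 s x t.
  move=> hx st; split; first by clear -hx m0 z0; lra.
    move=> tT; apply: (@le_lt_trans _ _ (v * T)); first by rewrite ler_pM2l.
    by rewrite vT; clear -hx z0; lra.
  by move=> _; rewrite vT vz; clear -hx; lra.
pose yy t := x0 + v * (t - s) + z.
have during t : s <= t -> t <= s + T -> U' 0%N (yy t) t < 0.
  move=> st tT; have vt0 : 0 <= v * (t - s) by rewrite mulr_ge0 ?(ltW v0)// subr_ge0.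
  have vtm : v * (t - s) <= m by rewrite -vT ler_pM2l// lerBlDl.
  have yyy : y <= yy t by rewrite /yy x0E; clear -zy vt0 z0; lra.
  have ct : c0 < t by exact: lt_le_trans st.
  rewrite U'E; have [vt|vt] := ltP (v * (t - s)) z.
    have P0 : 0 <= profile v T 0%N (yy t - x0) (t - s).
      by apply: profile0_ge0 => //; [exact: ltW|rewrite ltNge lerBlDl tT].
    have : U 0%N (yy t) t <= U 0%N (yy t) s by apply: dec.
    have : U 0%N (yy t) s < U 0%N G s by apply: inc => //; rewrite /yy x0E; clear -vt z0; lra.
    by rewrite fG; have := mulr_ge0 (ltW b0) P0; clear; lra.
  have t1 : 0 < t - s.
    by rewrite lt_neqAle subr_ge0 st andbT eq_sym; apply: contraTneq vt => ->; rewrite mulr0 -ltNge.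
  have := @profile0_wave R v T v0 (t - s) t1 _ _; rewrite vz => /(_ _ vt) hP.
  have {}hP : expR (-1) / 2 <= profile v T 0%N (v * (t - s) + z) (t - s) by apply: hP; rewrite lerBlDl.
  have -> : yy t - x0 = v * (t - s) + z by rewrite /yy; ring.
  have : b * (expR (-1) / 2) <= b * profile v T 0%N (v * (t - s) + z) (t - s).
    by rewrite ler_pM2l.
  have : U 0%N (yy t) t <= U 0%N (yy t) s by apply: dec.
  have : U 0%N (yy t) s <= U 0%N (G + m) s.
    have : yy t <= G + m by rewrite /yy x0E; clear -vtm z0; lra.
    by rewrite le_eqVlt => /predU1P[->//|h]; apply/ltW/inc.
  clear -Um; lra.
have [y' y'E] : exists y', y' = x0 + m + z by exists (x0 + m + z).
have yy' : y <= y' by rewrite y'E x0E; clear -zy m0 z0; lra.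
have yyT : yy (s + T) = y' by rewrite /yy y'E [s + T]addrC addrK vT.
have sT0 : s <= s + T by rewrite lerDl ltW.
have later t : s + T <= t -> U' 0%N y' t < 0.
  move=> tT; apply: le_lt_trans (during (s + T) sT0 (lexx _)); rewrite yyT.
  apply: (regular_le tT) => u /andP[u1 u2]; rewrite U'D; apply: pert_regular.
  have su : s <= u := le_trans sT0 u1.
  apply: (bT _ _ yy' (lt_le_trans c0s su)); apply: after su; by rewrite y'E.
exists p', (a * z), (s + T); rewrite -U'D.
split.
- exists y', (s + T); rewrite sS -U'D; split.
  + by rewrite ltrD2l.
  + by apply: later; rewrite lerD2l ltW.
  + move=> x t yx sTt; have yx' := le_trans yy' yx.
    have st : s <= t := le_trans sT0 (ltW sTt).
    have ct : c0 < t := lt_le_trans c0s st.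
    have hxx : m <= x - x0 by rewrite y'E in yx; clear -yx z0; lra.
    split; first by apply: (bT _ _ yx' ct); apply: after st; rewrite -y'E.
    have [_ hp] := ok x t yx' ct.
    have : b * profile v T 0%N (x - x0) (t - s) <= b * (2 + stop_weight).
      rewrite ler_pM2l//; apply: profile0_le => //; first exact: ltW.
        by move=> tsT; apply: le_trans hxx; rewrite -vT ler_pM2l.
      by rewrite vT.
    by rewrite p'E /add_wave; clear -hp hb; lra.
  + move=> x t t' yx tt' t'1; have yx' := le_trans yy' yx.
    rewrite p'E /add_wave.
    have h1 := incr x t t' yx' tt' t'1.
    have h2 := @profile_incr b v T (k * d) d (x - x0) t t' (ltW b0) v0 (ltW T0) d0 _ zTd _ _ tt' t'1 hb1 hb2;
    rewrite -sE in h2.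
    have {}h2 : b * (profile v T 0%N (x - x0) (t' - s) - profile v T 0%N (x - x0) (t - s)) <=
        k * d * Num.sqrt (1 - t).
      apply: h2; first by rewrite mulr_ge0// ltW.
        by rewrite vz expr2; apply: le_trans zd; rewrite ler_piMl// ltW.
      by rewrite vT; rewrite y'E in yx; clear -yx z0; lra.
    have -> : k * (1 - 2 * (d / 2)) * Num.sqrt (1 - t) =
      k * (1 - 2 * d) * Num.sqrt (1 - t) + k * d * Num.sqrt (1 - t) by field.
    by rewrite opprD addrACA lerD// -mulrBr.
- by move=> j x t ts; rewrite p'E; apply: add_wave_le ts; exact: ltW.
- move=> t1 /andP[st1 t1s]; have [tT|tT] := leP t1 (s + T).
    exists (yy t1); split; first exact: during.
    have vt1 : 0 <= v * (t1 - s) by rewrite mulr_ge0 ?(ltW v0)// subr_ge0.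
    have zz : 0 < z ^+ 2 by rewrite exprn_gt0.
    (* Times past the stop occur near [t1] only if [t1] is the stopping time; then [yy t1] has
       exactly the margin that [ahead] requires. *)
    have nearT : \forall t \near t1, T < t - s -> t1 = s + T.
      move: tT; rewrite le_eqVlt => /predU1P[->|tT]; first by near=> t.
      near=> t => Tt; exfalso; have : t < s + T by near: t; exact: lt_nbhsl.
      by rewrite -ltrBlDl => /(lt_trans Tt); rewrite ltxx.
    near=> t => x yx; rewrite U'D; apply: pert_regular; apply: bT.
    + by apply: le_trans yx; rewrite /yy x0E; clear -zy vt1 z0; lra.
    + by near: t; apply: lt_nbhsr; exact: lt_le_trans st1.
    split.
    + by apply: lt_le_trans yx; rewrite /yy; clear -vt1 z0; lra.
    + move=> _; apply: (@lt_le_trans _ _ (v * (t1 - s) + z)); last first.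
        by move: yx; rewrite /yy; clear; lra.
      (* The wave needs time [z ^+ 2] to cross the margin [z], so it remains behind [yy t1] for t <
         t1 + z^2. *)
      have -> : z = v * z ^+ 2 by rewrite vE expr2 mulrA mulVf ?mul1r// gt_eqF.
      rewrite -mulrDr ltr_pM2l//.
      have : t < t1 + z ^+ 2 by near: t; apply: lt_nbhsl; rewrite ltrDl.
      by clear; lra.
    + have h : T < t - s -> t1 = s + T by near: t.
      move=> /h E; move: yx; rewrite /yy E vz [s + T]addrC addrK vT; clear; lra.
  exists y'; split; first by apply: later; exact: ltW.
  near=> t => x yx; rewrite U'D; apply: pert_regular.
  have Tt : s + T < t by near: t; exact: lt_nbhsr.
  have st : s <= t by apply: ltW; exact: le_lt_trans sT0 Tt.
  by apply: (bT _ _ (le_trans yy' yx) (lt_le_trans c0s st)); apply: after st; rewrite -y'E.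
- by split=> //; rewrite mulr_gt0.
split; first by rewrite ltrDl T0 ltrD2l.
have csT : c0 < s + T := lt_le_trans c0s sT0.
have reg' x : y' <= x -> regular_at U' x (s + T).
  move=> yx; rewrite U'D; apply: pert_regular.
  by apply: (bT _ _ (le_trans yy' yx) csT); apply: after sT0; rewrite -y'E.
have [f0 yf _] := frontP (later _ (lexx _)) reg'.
set f := front U' (s + T) in f0 yf *.
have az0 : 0 < a * z by rewrite mulr_gt0.
have hx : y' <= a * z + f by clear -az0 yf; lra.
(* The new front is beyond G + m / 2, where the old solution exceeds [om]; the step part b exp (- m
   / (4 z)) and the wave part b exp (- a) each remove at most om / 4. *)
have qlow : om / 2 <= U' 0%N (a * z + f) (s + T).
  rewrite U'E [s + T - s]addrAC subrr add0r.
  have u1 : om < U 0%N (G + m / 2) (s + T).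
    by apply: he; rewrite addrAC subrr add0r gtr0_norm//; clear -zT e0; lra.
  have u2 : U 0%N (G + m / 2) (s + T) < U 0%N (a * z + f) (s + T).
    apply: inc => //; rewrite y'E x0E in hx yf; clear -zm m0 z0 az0 yf; lra.
  have hxv : v * T <= a * z + f - x0.
    by rewrite vT; rewrite y'E in yf; clear -yf az0 z0; lra.
  have P := @profile0_end R v T v0 (a * z + f - x0) T0 hxv.
  have P1 : b * expR (- (v ^+ 2 * T / 4)) <= om / 4.
    have -> : v ^+ 2 * T / 4 = m / (4 * z).
      by rewrite expr2 -[v * v * T]mulrA vT vE; field; rewrite gt_eqF.
    have u0 : 0 < m / (4 * z) by rewrite divr_gt0// mulr_gt0.
    apply: le_trans zom; rewrite -[4 * b / m * z]mulrA [4 * b]mulrC -!mulrA ler_pM2l//.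
    have -> : 4 * (m^-1 * z) = (m / (4 * z))^-1 by rewrite invf_div; field; rewrite gt_eqF.
    rewrite expRN lef_pV2 ?posrE ?expR_gt0//; apply: le_trans (expR_ge1Dx _).
    by rewrite lerDr.
  have P2 : b * expR (- (v * (a * z + f - x0 - v * T))) <= om / 4.
    apply: le_trans bea; rewrite ler_pM2l// ler_expR lerN2.
    apply: (@le_trans _ _ (v * (a * z))).
      by rewrite mulrCA vE mulVf ?mulr1// gt_eqF.
    by rewrite ler_pM2l// vT; rewrite y'E in yf; clear -yf z0; lra.
  apply: (@le_trans _ _ (om - (om / 4 + om / 4))); first by clear; lra.
  apply: lerB; first exact: ltW (lt_trans u1 u2).
  apply: (@le_trans _ _ (b * (expR (- (v ^+ 2 * T / 4)) +
      expR (- (v * (a * z + f - x0 - v * T)))))); first by rewrite ler_pM2l.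
  by rewrite mulrDr; exact: lerD.
have lnN : N <= `|ln (a * z)|.
  have : ln (a * z) <= - N by rewrite -[- N]expRK ler_ln ?posrE ?expR_gt0.
  by move=> h; rewrite ler0_norm; clear -h N1; lra.
have pN : N <= `|ln (a * z)| `^ (3 / 2).
  exact: le_trans lnN (powR_ge_id (le_trans N1 lnN)).
apply: (@le_trans _ _ (om / 2 * N)).
  have -> : om / 2 * N = n%:R + om / 2 by rewrite /N; field; rewrite gt_eqF.
  by rewrite lerDl divr_ge0// ltW.
have N0 : 0 <= N := le_trans ler01 N1.
have om2 : 0 <= om / 2 by rewrite divr_ge0// ltW.
exact: ler_pM.
Unshelve. all: by end_near. Qed.

End Solution.

(** * Infinitely many waves *)

Section Limit.
Context {R : realType}.
Implicit Types (U p : nat -> R -> R -> R) (x y t : R).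

Definition gap (n : nat) : R := 2^-1 ^+ n.+1.

Lemma gap_gt0 n : 0 < gap n. Proof. by rewrite exprn_gt0// invr_gt0. Qed.

Lemma gapS n : gap n.+1 = gap n / 2. Proof. by rewrite /gap exprSr. Qed.

Lemma gap_decr : {homo gap : n m / (n <= m)%N >-> m <= n}.
Proof.
apply/nonincreasing_seqP => n; rewrite gapS.
by have := gap_gt0 n; lra.
Qed.

Lemma gap_le_half n : gap n <= 2^-1.
Proof. by rewrite (le_trans (gap_decr (leq0n n)))// /gap expr1. Qed.

Lemma cvg_gap : gap n @[n --> \oo] --> 0.
Proof.
have h : (2^-1 : R) ^+ n @[n --> \oo] --> 0.
  by apply: cvg_expr; rewrite gtr0_norm ?invr_gt0// invf_lt1// ltr1n.
have -> : gap = (fun n => 2^-1 * 2^-1 ^+ n) by apply/funext => n; rewrite /gap exprS.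
have : (2^-1 : R) * 2^-1 ^+ n @[n --> \oo] --> (2^-1 : R) * 0 by exact: cvgMr.
by rewrite mulr0.
Qed.

Lemma gap_lt e : 0 < e -> exists n, gap n < e.
Proof.
move=> e0; have /cvgrPdist_lt /(_ e e0) [n _ h] := cvg_gap.
by exists n; have := h n (leqnn n); rewrite /= sub0r normrN gtr0_norm ?gap_gt0.
Qed.

Lemma caloric_zero x t : caloric_at (fun _ _ _ => 0 : R) x t.
Proof. by move=> j; split; [exact: is_derive_cst|exact: is_derive_cst|exact: cvg_cst]. Qed.

Lemma pert_ok_zero x t : pert_ok (fun _ _ _ => 0 : R) x t.
Proof.
by split=> //=; [exact: caloric_zero|rewrite lexx invr_ge0 ler0n].
Qed.

Lemma stage0 k : stage k (gap 0) (fun _ _ _ => 0).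
Proof.
have g0 : gap 0 = 2^-1 by rewrite /gap expr1.
exists 0, 0; rewrite g0; split.
- by rewrite subr_gt0 invf_lt1// ltr1n.
- rewrite sol0E !subr0 subr_lt0; apply: lt_le_trans (expR_ge1Dx _); lra.
- by move=> x t _ _; split; [exact: pert_ok_zero|rewrite subrr].
- by move=> x t t' _ _ _; rewrite subrr mulr_ge0 ?sqrtr_ge0// (_ : 1 - 2 / 2 = 0) ?mulr0//; field.
Qed.

Lemma stages k : 0 < k -> exists (P : nat -> nat -> R -> R -> R) (r t : nat -> R),
  (forall j x s, P 0%N j x s = 0) /\ forall n,
  [/\ stage k (gap n) (P n),
      forall j x s, s <= 1 - gap n -> P n.+1 j x s = P n j x s,
      forall s, 1 - gap n <= s <= 1 - gap n.+1 -> good (sol (P n.+1)) s,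
      [/\ 0 < r n, r n.+1 < r n & r n.+1 <= gap n] &
      1 - gap n < t n < 1 - gap n.+1 /\ n%:R <=
        sol (P n.+1) 0%N (r n.+1 + front (sol (P n.+1)) (t n)) (t n)
        * `|ln (r n.+1)| `^ (3 / 2)].
Proof.
move=> k0; pose tower := nat -> R -> R -> R.
pose A n := {a : tower * R | stage k (gap n) a.1 /\ 0 < a.2}.
have next n (a : A n) : exists b : A n.+1 * R,
  [/\ forall j x s, s <= 1 - gap n -> (sval b.1).1 j x s = (sval a).1 j x s,
      forall s, 1 - gap n <= s <= 1 - gap n.+1 -> good (sol (sval b.1).1) s,
      (sval b.1).2 < (sval a).2, (sval b.1).2 <= gap n &
      1 - gap n < b.2 < 1 - gap n.+1 /\ n%:R <=
        sol (sval b.1).1 0%N ((sval b.1).2 + front (sol (sval b.1).1) b.2) b.2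
        * `|ln (sval b.1).2| `^ (3 / 2)].
  (* Passing half of the previous radius makes the radii strictly decreasing. *)
  case: a => -[p r] /= [ps r0]; have r2 : 0 < r / 2 by rewrite divr_gt0.
  have [p' [r' [t' [s' e' g' [r'0 r'le] h]]]] := next_stage n k0 r2 (gap_gt0 n) ps.
  rewrite -gapS in s' g' h; move: r'le; rewrite le_min => /andP[r'1 r'2].
  exists (exist _ (p', r') (conj s' r'0), t') => /=; split=> //.
  by apply: le_lt_trans r'1 _; rewrite ltr_pdivrMr// ltr_pMr// ltr1n.
pose a0 : A 0%N := exist _ (fun _ _ _ => 0, 1) (conj (stage0 k) ltr01).
pose a := fix a n : A n := if n is m.+1 then (sval (cid (next m (a m)))).1 else a0.
exists (fun n => (sval (a n)).1), (fun n => (sval (a n)).2),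
  (fun n => (sval (cid (next n (a n)))).2); split => // n.
have [h1 h2 h3 h4 h5] := svalP (cid (next n (a n))).
by have [s1 s2] := svalP (a n); split.
Qed.

Lemma front_eq U1 U2 t : (forall x, U1 0%N x t = U2 0%N x t) ->
  front U1 t = front U2 t.
Proof.
move=> e; congr xget; apply/funext => x; apply/propext; rewrite /= e.
by split=> -[h1 h2]; split=> // y /h2; rewrite e.
Qed.

Lemma good_eq U1 U2 c t : t < c ->
  (forall j x s, s < c -> U1 j x s = U2 j x s) -> good U1 t -> good U2 t.
Proof.
move=> tc e [y [yneg h]]; exists y; split; first by rewrite -e.
near=> s => x yx; have sc : s < c by near: s; exact: lt_nbhsl.
have : forall x, y <= x -> regular_at U1 x s by near: s.
move=> /(_ x yx) [h1 h2 h3 h4]; split; rewrite -?e//.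
apply: (caloric_at_near _ h1).
near=> s' => j z; apply: e; near: s'; exact: lt_nbhsl.
Unshelve. all: by end_near. Qed.

Section Sequence.
Variables (k : R) (P : nat -> nat -> R -> R -> R).
Hypothesis k0 : 0 < k.
Hypothesis P0 : forall j x s, P 0%N j x s = 0.
Hypothesis stP : forall n, stage k (gap n) (P n).
Hypothesis stageE : forall n j x s, s <= 1 - gap n -> P n.+1 j x s = P n j x s.
Hypothesis goodP : forall n s, 1 - gap n <= s <= 1 - gap n.+1 -> good (sol (P n.+1)) s.

Lemma eq_stages n m j x s : (n <= m)%N -> s <= 1 - gap n -> P m j x s = P n j x s.
Proof.
elim: m => [|m ih]; first by rewrite leqn0 => /eqP ->.
rewrite leq_eqVlt => /predU1P[-> //|nm] sn; rewrite stageE ?ih//.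
by rewrite (le_trans sn)// lerD2l lerN2 gap_decr.
Qed.

(* Any [n] with [t < 1 - gap n] gives the same value, see [limitE]. *)
Definition limit (j : nat) x s : R := P (xget 0%N [set n | s < 1 - gap n]) j x s.

Lemma limitE n j x s : s <= 1 - gap n -> limit j x s = P n j x s.
Proof.
move=> sn; rewrite /limit; case: xgetP => [m _ /= sm|h].
  have [nm|/ltnW mn] := leqP n m; first exact: eq_stages.
  by apply/esym/eq_stages => //; exact: ltW.
exfalso; apply: (h n.+1); rewrite /= (le_lt_trans sn)// ltrD2l ltrN2 gapS.
by have := gap_gt0 n; lra.
Qed.

Local Notation U := (sol limit).

Lemma sol_limitE n j x s : s <= 1 - gap n -> U j x s = sol (P n) j x s.
Proof. by move=> sn; rewrite /sol (limitE _ _ sn). Qed.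

Opaque limit sol.

(** Before any time below 1 only finitely many waves have started, and none before 1 - gap 0 = 1/2;
    the induction finds the stage that contains [s]. *)
Lemma good_limit s : s < 1 -> good U s.
Proof.
move=> s1; have [n] : exists n, s < 1 - gap n.
  have [|n hn] := @gap_lt (1 - s); first by rewrite subr_gt0.
  by exists n; lra.
elim: n => [|n ih] sn.
  apply: (@good_eq (sol (P 0%N)) _ _ _ sn).
    by move=> j x u us; rewrite (@sol_limitE 0%N)// ltW.
  exists (s - 1); split.
    rewrite sol0E P0 subr0 subr_lt0 opprB addrCA subrr addr0.
    by rewrite (lt_le_trans _ (expR_ge1Dx 1))// ltrDr.
  near=> u => x _; apply: pert_regular.
  have -> : P 0%N = (fun _ _ _ => 0).
    by apply/funext => j; apply/funext => z; apply/funext => v; exact: P0.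
  exact: pert_ok_zero.
have [/ih//|ns] := ltP s (1 - gap n).
apply: (@good_eq (sol (P n.+1)) _ _ _ sn).
  by move=> j x u us; rewrite (@sol_limitE n.+1)// ltW.
by apply: goodP; rewrite ns ltW.
Unshelve. all: by end_near. Qed.

Lemma limit_at0 x : U 0%N x 0 = 1 - expR (- x).
Proof.
rewrite (@sol_limitE 0%N); last by have := gap_le_half 0; lra.
by rewrite sol0E P0 subr0 sub0r.
Qed.

Lemma front_limit_nondecr s s' : s <= s' -> s' < 1 -> front U s <= front U s'.
Proof.
move=> ss s'1; apply: (@le_of_derive_ge0 R _ (front_speed U) _ _ ss) => u /andP[_ us];
  have gu := good_limit (le_lt_trans us s'1).
- exact: is_derive_front.
- exact: front_speed_ge0.
Qed.

(** Compare at x, the front at the later time s' = 1 - gap n. There U vanishes at s', so its value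
    at s is its decrease in time: at most 1 - s from the exponential plus the budget of [stage]. At
    time s, U climbs from 0 to that value between the two front positions with slope at least
    1/8. *)
Lemma front_limit_incr s n : 0 <= s -> s <= 1 - gap n ->
  front U (1 - gap n) - front U s <= 8 * ((1 - s) + k * Num.sqrt (1 - s)).
Proof.
move=> s0 sn; set s' := 1 - gap n; set h := 1 - s.
have s'1 : s' < 1 by rewrite /s'; have := gap_gt0 n; lra.
have [y [c [cs yneg ok incr]]] := stP n.
have reg x : y <= x -> regular_at (sol (P n)) x s'.
  by move=> yx; apply: pert_regular; have [] := ok x s' yx cs.
have [f0 yf _] := frontP yneg reg.
have fE : front U s' = front (sol (P n)) s'.
  by apply: front_eq => z; rewrite (@sol_limitE n).
rewrite -fE in f0 yf; set x := front U s' in f0 yf *.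
have [_ _ _ /andP[l1 l2]] := reg x (ltW yf); rewrite f0 in l1 l2.
have ux : U 0%N x s <= h + k * Num.sqrt h.
  rewrite (@sol_limitE n)// -[leLHS]subr0 -f0 !sol0E.
  have := incr x s s' (ltW yf) sn (ltW s'1).
  have : k * (1 - 2 * gap n) * Num.sqrt h <= k * Num.sqrt h.
    rewrite ler_wpM2r ?sqrtr_ge0// ger_pMr//; have := gap_gt0 n; lra.
  have : expR (s' - x) - expR (s - x) <= h.
    have -> : expR (s' - x) - expR (s - x) = expR (s' - x) * (1 - expR (s - s')).
      by rewrite mulrBr mulr1 -expRD; congr (_ - expR _); ring.
    have e1 := expR_ge1Dx (s - s').
    apply: (@le_trans _ _ (1 * (s' - s))).
      rewrite ler_pM ?expR_ge0// ?subr_ge0; [|lra..].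
      by rewrite expR_le1 subr_le0.
    by rewrite mul1r lerD2r ltW.
  rewrite -/h; lra.
have fs : front U s <= x by exact: front_limit_nondecr sn s'1.
have s1 : s < 1 := le_lt_trans sn s'1.
have low : 1 / 8 * x - 1 / 8 * front U s <= U 0%N x s - U 0%N (front U s) s.
  apply: (@sub_le_of_derive_le R (fun z => 1 / 8 * z) (U 0%N ^~ s)
    (fun=> 1 / 8) (U 1%N ^~ s) _ _ fs) => z /andP[fz zx].
  - by apply: (@is_derive_affine _ _ _ 0) => u; rewrite add0r.
  - by have [/(_ 0%N)[]] := front_regular (good_limit s1) fz erefl.
  have [_ + _ _] := front_regular (good_limit s1) fz erefl; apply: le_trans.
  (* The slope bound: exp (s' - x) >= 1/2 because U vanishes at (x, s'), and s - z >= (s' - x) - 1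
     costs a factor exp (-1) >= 1/4. *)
  have e2 : expR (s' - x) * (expR (-(1/2)) * expR (-(1/2))) <= expR (s - z).
    rewrite -!expRD ler_expR; have := gap_gt0 n; rewrite /s'; lra.
  apply: le_trans e2; have e3 := @expR_ge1Dx R (-(1/2)).
  have -> : 1 / 8 = 1 / 2 * (1 / 2 * (1 / 2)) :> R by field.
  have e4 : 1 / 2 <= expR (-(1/2)) :> R by lra.
  apply: ler_pM; [by rewrite divr_ge0|by rewrite mulr_ge0 ?divr_ge0|lra|].
  by apply: ler_pM; rewrite ?divr_ge0.
rewrite (front0 (good_limit s1)) subr0 in low; lra.
Qed.

End Sequence.
End Limit.

(** * The terminal bound *)

Section TerminalBound.
Context {R : realType}.
Local Notation mu := (@lebesgue_measure R).

(** As [g] may blow up at [b], the fundamental theorem is applied on [[a, b - 1 / (n + 1)]], and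
    monotone exhaustion passes the bound to the limit. *)
Lemma integral_derive_le (g G : R -> R) (a b c : R) : a < b ->
  (forall t, t < b -> is_derive t 1 G (g t)) ->
  (forall t, t < b -> 0 <= g t) ->
  (forall t, t < b -> {for t, continuous g}) ->
  (forall t, a <= t < b -> G t - G a <= c) ->
  (\int[mu]_(t in `[a, b[) (g t)%:E <= c%:E)%E.
Proof.
move=> ab dG g0 cg Gc.
have bn n : b - n.+1%:R^-1 < b by rewrite ltrBlDr ltrDl invr_gt0.
have within_cont n : {within `[a, b - n.+1%:R^-1], continuous g}.
  apply: continuous_in_subspaceT => t; rewrite inE /= in_itv /= => /andP[_ tb].
  by apply: cg; exact: le_lt_trans tb (bn n).
rewrite itv_bnd_open_bigcup.
apply: cvge_le (ge0_nondecreasing_set_cvg_integral _ _ _ _); first last.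
- move=> n t /=; rewrite in_itv /= lee_fin => /andP[_ tb].
  by apply: g0; exact: le_lt_trans tb (bn n).
- move=> n; apply/measurable_EFinP; apply: subspace_continuous_measurable_fun.
    exact: measurable_itv.
  exact: within_cont.
- by move=> n; exact: measurable_itv.
- apply/nondecreasing_seqP => n; rewrite subsetEset; apply: subset_itvl.
  by rewrite bnd_simp lerD2l lerN2 lef_pV2 ?posrE// ler_nat.
have ba0 : 0 < b - a by rewrite subr_gt0.
near=> n; have abn : a < b - n.+1%:R^-1.
  rewrite ltrBrDr -ltrBrDl; near: n; exact: (near_infty_natSinv_lt (PosNum ba0)).
rewrite (@continuous_FTC2 R g G _ _ abn)//.
- by rewrite -EFinB lee_fin; apply: Gc; rewrite (ltW abn) bn.
- have cG t : t < b -> {for t, continuous G}.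
    by move=> tb; have := dG t tb; exact: is_derive_continuous.
  split=> [t|  |].
  + by rewrite in_itv /= => /andP[_ tb]; case: (dG t (lt_trans tb (bn n))).
  + by apply: cvg_at_right_filter; exact: cG.
  + by apply: cvg_at_left_filter; exact: cG.
- move=> t; rewrite in_itv /= => /andP[_ tb].
  by rewrite derive1E; case: (dG t (lt_trans tb (bn n))).
Unshelve. all: by end_near. Qed.

(** Once sqrt h <= K / 16, both terms of the increment are at most K / 16 sqrt h, and 8 times their
    sum is K sqrt h; for h <= 1 the iterated logarithm is at least 1. *)
Lemma terminal_bound_front_speed (K : R) U : 0 < K ->
  (forall t, t < 1 -> good U t) ->
  (forall s t, 0 <= s <= t -> t < 1 ->
    front U t - front U s <= 8 * ((1 - s) + K / 16 * Num.sqrt (1 - s))) ->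
  terminal_bound K (front_speed U).
Proof.
move=> K0 gU incr.
have m0 : 0 < Num.min 1 ((K / 16) ^+ 2) by rewrite lt_min ltr01 exprn_gt0// divr_gt0.
near=> h; have h0 : 0 < h by near: h; exact: nbhs_right_gt.
have : h <= Num.min 1 ((K / 16) ^+ 2) by near: h; exact: nbhs_right_le.
rewrite le_min => /andP[h1 hK].
have sK : Num.sqrt h <= K / 16.
  by rewrite -(ger0_norm (ltW (divr_gt0 K0 _)))// -sqrtr_sqr ler_wsqrtr.
have K1 : 0 <= K / 16 by rewrite divr_ge0// ltW.
have : 8 * (h + K / 16 * Num.sqrt h) <= K * Num.sqrt (h * ln (ln (expR (expR 1) / h))).
  apply: (@le_trans _ _ (K * Num.sqrt h)).
    have : h <= K / 16 * Num.sqrt h.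
      by rewrite -{1}(sqr_sqrtr (ltW h0)) expr2 ler_wpM2r// sqrtr_ge0.
    lra.
  rewrite ler_wpM2l ?(ltW K0)// ler_wsqrtr// ler_peMr ?(ltW h0)//.
  have e1 : expR 1 <= ln (expR (expR 1) / h).
    rewrite -[leLHS]expRK ler_ln ?posrE ?divr_gt0 ?expR_gt0//.
    by rewrite ler_pdivlMr// ler_piMr// expR_ge0.
  by rewrite -[leLHS]expRK ler_ln ?posrE ?expR_gt0// (lt_le_trans (expR_gt0 1)).
move=> hb; apply: le_trans (_ : ((8 * (h + K / 16 * Num.sqrt h))%:E <= _)%E).
  apply: (@integral_derive_le _ (front U)); first by rewrite gtrBl.
  - by move=> t t1; exact: is_derive_front (gU t t1).
  - by move=> t t1; exact: front_speed_ge0 (gU t t1).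
  - by move=> t t1; exact: is_derive_continuous (is_derive_eval speed_expr (gU t t1)).
  move=> t /andP[ht t1]; have := incr (1 - h) t _ t1; rewrite subKr; apply.
  by rewrite ht subr_ge0 h1.
by rewrite lee_fin.
Unshelve. all: by end_near. Qed.

End TerminalBound.

Lemma not_log_modulus {R : realType} (q : R -> R -> R) (t r : nat -> R) :
  (forall n, 0 < t n < 1) -> (forall n, 0 < r n) -> r n @[n --> \oo] --> 0 ->
  q (r n) (t n) * `|ln (r n)| `^ (3 / 2) @[n --> \oo] --> +oo -> ~ log_modulus q.
Proof.
move=> t01 r0 cr cq [C logC].
have C1 : \forall n \near \oo, r n < 1 /\
    forall t, 0 < t < 1 -> q (r n) t <= C * `|ln (r n)| `^ (- (3 / 2)).
  have [d /= d0 hd] := logC; move/cvgrPdist_lt : cr => cr.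
  near=> n; split.
    have : `|0 - r n| < 1 by near: n; exact: cr.
    by rewrite sub0r normrN gtr0_norm.
  by apply: hd => //=; near: n; exact: cr.
move/cvgryPge : cq => /(_ (C + 1)) cq.
have [n [[rn1 qn] qC]] := filter_ex (filterI C1 cq).
have l0 : 0 < `|ln (r n)| by rewrite normr_gt0 lt_eqF// ln_lt0// r0 rn1.
have := qn _ (t01 n); rewrite powRN -ler_pdivrMr ?invr_gt0 ?powR_gt0// invrK.
by move=> /(le_trans qC); rewrite gerDl ler10.
Unshelve. all: by end_near. Qed.

Theorem proposition4p5 (R : realType) :
  (forall K : R, 0 < K ->
    exists (g : R -> R) (q : R -> R -> R),
      [/\ drift_diffusion_pair g q,
          terminal_bound K g &
          exists (t r : nat -> R),
            [/\ (forall n, 0 < t n < 1),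
                increasing_seq t /\ t n @[n --> \oo] --> (1 : R),
                (forall n, 0 < r n),
                decreasing_seq r /\ r n @[n --> \oo] --> (0 : R) &
                q (r n) (t n) * `|ln (r n)| `^ (3 / 2) @[n --> \oo] --> +oo]])
  /\
  (forall K : R, 0 < K ->
    ~ (forall (g : R -> R) (q : R -> R -> R),
         drift_diffusion_pair g q -> terminal_bound K g -> log_modulus q)).
Proof.
(* The second claim is refuted by the pair that the first one provides. *)
have and_dep (A B : Prop) : A -> (A -> B) -> A /\ B by move=> a b; split=> //; exact: b.
apply: and_dep => [K K0|part1 K K0 mod]; last first.
  have [g [q [dd tb [t [r [t01 [_ _] r0 [_ cr] cq]]]]]] := part1 K K0.
  by apply: (not_log_modulus t01 r0 cr cq); exact: mod dd tb.
have k0 : 0 < K / 16 by rewrite divr_gt0.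
have [P [r [t [P0 h]]]] := stages k0.
have stP n : stage (K / 16) (gap n) (P n) by have [] := h n.
have stageE n j x s : s <= 1 - gap n -> P n.+1 j x s = P n j x s.
  by have [_ + _ _ _] := h n; apply.
have goodP n s : 1 - gap n <= s <= 1 - gap n.+1 -> good (sol (P n.+1)) s.
  by have [_ _ + _ _] := h n; apply.
have rP n : [/\ 0 < r n, r n.+1 < r n & r n.+1 <= gap n] by have [] := h n.
have tP n : 1 - gap n < t n < 1 - gap n.+1 by have [_ _ _ _ []] := h n.
have t01 n : 0 < t n < 1.
  have /andP[t1 t2] := tP n; apply/andP; split.
    by apply: le_lt_trans t1; have := @gap_le_half R n; lra.
  by apply: lt_trans t2 _; rewrite ltrBlDr ltrDl gap_gt0.
have gU := good_limit P0 stageE goodP; have U0 := limit_at0 P0 stageE.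
set U := sol (limit P) in gU U0.
exists (front_speed U), (fun r t => U 0%N (r + front U t) t); split.
- exact: pair_front gU U0.
- apply: terminal_bound_front_speed => // s s' /andP[s0 ss] s'1.
  have [|n hn] := @gap_lt R (1 - s'); first by rewrite subr_gt0.
  have sn : s' <= 1 - gap n by lra.
  apply: le_trans (front_limit_incr k0 P0 stP stageE goodP s0 (le_trans ss sn)).
  rewrite lerD2r; apply: (front_limit_nondecr P0 stageE goodP sn).
  by rewrite ltrBlDr ltrDl gap_gt0.
exists t, (fun n => r n.+1); split=> //.
- split.
    apply/increasing_seqP => n; have /andP[_ t1] := tP n; have /andP[t2 _] := tP n.+1.
    exact: lt_trans t1 t2.
  apply: (@squeeze_cvgr _ _ _ _ (fun n => 1 - gap n) (cst 1)).
  + by near=> n; have /andP[/ltW -> _] := tP n; have /andP[_ /ltW ->] := t01 n.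
  + rewrite -[X in _ --> X]subr0; apply: cvgB; [exact: cvg_cst|exact: cvg_gap].
  + exact: cvg_cst.
- by move=> n; have [] := rP n.+1.
- split; first by apply/decreasing_seqP => n; have [] := rP n.+1.
  apply: (@squeeze_cvgr _ _ _ _ (cst 0) gap).
  + by near=> n; have [_ _ ->] := rP n; have [/ltW ->] := rP n.+1.
  + exact: cvg_cst.
  + exact: cvg_gap.
apply: ger_cvgy (@cvgr_idn R); near=> n.
have [_ _ _ _ [_ big]] := h n; have /andP[_ /ltW tn] := tP n.
(* The time [t n] precedes the next launch, at 1 - gap n.+1, so the limit still equals stage n.+1
   there, front included. *)
have UE x : U 0%N x (t n) = sol (P n.+1) 0%N x (t n) by exact: sol_limitE.
by rewrite UE (front_eq UE).
Unshelve. all: by end_near. Qed.
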